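(* Let $\bar\mu:\mathbb{R}\to\mathbb{R}$ be a smooth function and $\bar\lambda(t)=e^{-2t}$. Let $$M_1=\begin{pmatrix}1&0\\0&-1\end{pmatrix},\quad M_2=\begin{pmatrix}0&1\\-1&0\end{pmatrix},\quad M_3=\begin{pmatrix}0&1\\1&0\end{pmatrix},$$ and let $F,H,B$ be the $2\times2$ real matrix-valued functions of $t$ forming the unique solution, on an open interval $]a,b[$ containing $0$ $(a,b\in\mathbb{R})$, of $$F'=2H,\quad H'=2\bar\lambda^2F-2H-\bar\mu B,\quad B'=\bar\mu H-2B,\qquad F(0)=M_2,\ H(0)=M_3,\ B(0)=M_1.$$ Put $G=-M_2F$, with entries $G_{ij}$, and let $\varphi^i_j$ denote the entry of $F$ in row $i$, column $j$. On $M=\,]a,b[\,\times\mathbb{R}^2$ with global coordinates $(t,x_1,x_2)$ set $$\xi=\frac{\partial}{\partial t},\quad \eta=dt,\quad g=dt\otimes dt+e^{2t}\sum_{i,j=1}^2G_{ij}\,dx_i\otimes dx_j,\quad \varphi=\sum_{i,j=1}^2\varphi^i_j\,dx_j\otimes\frac{\partial}{\partial x_i},$$ and $\mu(t,x_1,x_2)=\bar\mu(t)$. Then $(M,\varphi,\xi,\eta,g)$ is an almost Kenmotsu generalized $(\kappa,\mu)$-manifold with $\kappa=-1-e^{-4t}$ and $d\kappa\wedge\eta=0$.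
   Context: An almost contact metric manifold $(M^{2n+1},\varphi,\xi,\eta,g)$ is a manifold with a $(1,1)$-tensor field $\varphi$, a vector field $\xi$, a $1$-form $\eta$ and a Riemannian metric $g$ such that $\varphi^2=-I+\eta\otimes\xi$, $\eta(\xi)=1$ and $g(\varphi X,\varphi Y)=g(X,Y)-\eta(X)\eta(Y)$. Its fundamental $2$-form is $\Phi(X,Y)=g(X,\varphi Y)$. It is almost Kenmotsu if $d\eta=0$ and $d\Phi=2\eta\wedge\Phi$. Put $h:=\frac12\mathcal{L}_{\xi}\varphi$, where $\mathcal L$ is the Lie derivative. With $R(X,Y)=[\nabla_X,\nabla_Y]-\nabla_{[X,Y]}$ ($\nabla$ the Levi-Civita connection of $g$), an almost Kenmotsu manifold is called a generalized $(\kappa,\mu)$-manifold, for smooth functions $\kappa,\mu$ on $M$, if for all vector fields $X,Y$: $R(X,Y)\xi=\kappa(\eta(Y)X-\eta(X)Y)+\mu(\eta(Y)hX-\eta(X)hY)$. A prime on a matrix denotes the entrywise derivative in $t$. *)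

(* Defs.v *)
From HB Require Import structures.
From mathcomp Require Import all_boot all_order all_algebra.
From mathcomp Require Import all_classical all_reals all_analysis.

Set Implicit Arguments.
Unset Strict Implicit.
Unset Printing Implicit Defensive.

Import Order.TTheory GRing.Theory Num.Theory.
Import numFieldNormedType.Exports.

Local Open Scope classical_set_scope.
Local Open Scope ring_scope.

(* A manifold carrying global coordinates is represented by an open subset U of
   R^(m+1).  Points and tangent vectors are column vectors, covectors are row
   vectors, and tensor fields are total functions of the point of which only
   the restriction to U matters.  Entry (i, j) of a (1,1)-tensor phi is the
   coefficient of dx_j (x) d/dx_i, so phi acts by phi x *m u; a covariant
   2-tensor g acts by u^T *m g x *m v. *)

Section DifferentialGeometry.
Variables (R : realType) (m : nat).
Local Notation E := 'cV[R]_m.+1.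
Implicit Types (U : set E) (f : E -> R) (X Y Z : E -> E).

Definition partial (i : 'I_m.+1) f : E -> R :=
  fun x => 'D_(delta_mx i 0 : E) f x.

(* C^infinity on U (assumed open): all iterated partial derivatives are
   differentiable, hence continuous, at every point of U. *)
Definition smooth_on U f :=
  forall (s : seq 'I_m.+1) (x : E), U x -> differentiable (foldr partial f s) x.

Definition smooth_mx_on U p q (A : E -> 'M[R]_(p, q)) :=
  forall i j, smooth_on U (fun x => A x i j).

Definition vfield_derive X f : E -> R := fun x => 'D_(X x) f x.

Definition lie_bracket X Y : E -> E := fun x => 'D_(X x) Y x - 'D_(Y x) X x.

Definition endo_app (phi : E -> 'M[R]_m.+1) X : E -> E := fun x => phi x *m X x.

Definition form_app (eta : E -> 'rV[R]_m.+1) X : E -> R :=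
  fun x => (eta x *m X x) 0 0.

Definition bilin (g : 'M[R]_m.+1) (u v : E) : R := (u^T *m g *m v) 0 0.

Definition bilin_app (g : E -> 'M[R]_m.+1) X Y : E -> R :=
  fun x => bilin (g x) (X x) (Y x).

Definition lie_derivative_endo X (phi : E -> 'M[R]_m.+1) Y : E -> E :=
  fun x => lie_bracket X (endo_app phi Y) x
           - endo_app phi (lie_bracket X Y) x.

(* Exterior derivatives and wedge products of forms, given by their values on
   vector fields.  The normalization is the one without factors 1/(p+1) in d
   and p!q!/(p+q)! in the wedge product. *)
Definition ext_derivative1 (w : (E -> E) -> E -> R) X Y : E -> R :=
  fun x => vfield_derive X (w Y) x - vfield_derive Y (w X) x
           - w (lie_bracket X Y) x.

Definition ext_derivative2 (w : (E -> E) -> (E -> E) -> E -> R) X Y Z : E -> R :=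
  fun x => vfield_derive X (w Y Z) x + vfield_derive Y (w Z X) x
           + vfield_derive Z (w X Y) x
           - w (lie_bracket X Y) Z x - w (lie_bracket Y Z) X x
           - w (lie_bracket Z X) Y x.

Definition wedge11 (v w : (E -> E) -> E -> R) X Y : E -> R :=
  fun x => v X x * w Y x - v Y x * w X x.

Definition wedge12 (v : (E -> E) -> E -> R)
    (w : (E -> E) -> (E -> E) -> E -> R) X Y Z : E -> R :=
  fun x => v X x * w Y Z x + v Y x * w Z X x + v Z x * w X Y x.

Definition differential f X : E -> R := vfield_derive X f.

Definition riemannian_metric U (g : E -> 'M[R]_m.+1) :=
  [/\ smooth_mx_on U g,
      forall x, U x -> (g x)^T = g x &
      forall x, U x -> forall u : E, u != 0 -> 0 < bilin (g x) u u].

(* The first field says that nabla only depends on the restrictions to U of its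
   arguments, i.e. that it is an operation on vector fields of U. *)
Record affine_connection U (nabla : (E -> E) -> (E -> E) -> E -> E) : Prop :=
  AffineConnection {
    connection_restr : forall X X' Y Y',
      smooth_mx_on U X -> smooth_mx_on U X' ->
      smooth_mx_on U Y -> smooth_mx_on U Y' ->
      (forall x, U x -> X x = X' x) -> (forall x, U x -> Y x = Y' x) ->
      forall x, U x -> nabla X Y x = nabla X' Y' x ;
    connection_smooth : forall X Y,
      smooth_mx_on U X -> smooth_mx_on U Y -> smooth_mx_on U (nabla X Y) ;
    connection_addl : forall X X' Y,
      smooth_mx_on U X -> smooth_mx_on U X' -> smooth_mx_on U Y ->
      forall x, U x ->
        nabla (fun y => X y + X' y) Y x = nabla X Y x + nabla X' Y x ;
    connection_scalel : forall f X Y,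
      smooth_on U f -> smooth_mx_on U X -> smooth_mx_on U Y ->
      forall x, U x -> nabla (fun y => f y *: X y) Y x = f x *: nabla X Y x ;
    connection_addr : forall X Y Y',
      smooth_mx_on U X -> smooth_mx_on U Y -> smooth_mx_on U Y' ->
      forall x, U x ->
        nabla X (fun y => Y y + Y' y) x = nabla X Y x + nabla X Y' x ;
    connection_leibniz : forall f X Y,
      smooth_on U f -> smooth_mx_on U X -> smooth_mx_on U Y ->
      forall x, U x ->
        nabla X (fun y => f y *: Y y) x
        = vfield_derive X f x *: Y x + f x *: nabla X Y x }.

Record levi_civita U (g : E -> 'M[R]_m.+1)
    (nabla : (E -> E) -> (E -> E) -> E -> E) : Prop := LeviCivita {
  levi_civita_connection : affine_connection U nabla ;
  levi_civita_torsion_free : forall X Y,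
    smooth_mx_on U X -> smooth_mx_on U Y ->
    forall x, U x -> nabla X Y x - nabla Y X x = lie_bracket X Y x ;
  levi_civita_metric : forall X Y Z,
    smooth_mx_on U X -> smooth_mx_on U Y -> smooth_mx_on U Z ->
    forall x, U x ->
      vfield_derive X (bilin_app g Y Z) x
      = bilin_app g (nabla X Y) Z x + bilin_app g Y (nabla X Z) x }.

Definition curvature (nabla : (E -> E) -> (E -> E) -> E -> E) X Y Z : E -> E :=
  fun x => nabla X (nabla Y Z) x - nabla Y (nabla X Z) x
           - nabla (lie_bracket X Y) Z x.

End DifferentialGeometry.

Section AlmostContact.
Variables (R : realType) (n : nat).
Local Notation E := 'cV[R]_(n.*2.+1).
Implicit Types (U : set E) (phi g : E -> 'M[R]_(n.*2.+1)) (xi : E -> E)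
  (eta : E -> 'rV[R]_(n.*2.+1)) (kappa mu : E -> R).

Record almost_contact_metric U phi xi eta g : Prop := AlmostContactMetric {
  acm_open : open U ;
  acm_smooth_phi : smooth_mx_on U phi ;
  acm_smooth_xi : smooth_mx_on U xi ;
  acm_smooth_eta : smooth_mx_on U eta ;
  acm_riemannian : riemannian_metric U g ;
  acm_phi_phi : forall x, U x -> phi x *m phi x = - 1%:M + xi x *m eta x ;
  acm_eta_xi : forall x, U x -> form_app eta xi x = 1 ;
  acm_compatible : forall X Y : E -> E,
    smooth_mx_on U X -> smooth_mx_on U Y ->
    forall x, U x ->
      bilin_app g (endo_app phi X) (endo_app phi Y) x
      = bilin_app g X Y x - form_app eta X x * form_app eta Y x }.

Definition fundamental_form phi g (X Y : E -> E) : E -> R :=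
  bilin_app g X (endo_app phi Y).

Record almost_kenmotsu U phi xi eta g : Prop := AlmostKenmotsu {
  ak_acm : almost_contact_metric U phi xi eta g ;
  ak_eta_closed : forall X Y : E -> E,
    smooth_mx_on U X -> smooth_mx_on U Y ->
    forall x, U x -> ext_derivative1 (form_app eta) X Y x = 0 ;
  ak_dPhi : forall X Y Z : E -> E,
    smooth_mx_on U X -> smooth_mx_on U Y -> smooth_mx_on U Z ->
    forall x, U x ->
      ext_derivative2 (fundamental_form phi g) X Y Z x
      = 2 * wedge12 (form_app eta) (fundamental_form phi g) X Y Z x }.

Definition h_tensor phi xi (X : E -> E) : E -> E :=
  fun x => 2^-1 *: lie_derivative_endo xi phi X x.

(* The Levi-Civita connection is unique on U, hence "exists nabla" amounts to
   "the Levi-Civita connection". *)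
Definition generalized_kappa_mu U phi xi eta g kappa mu : Prop :=
  [/\ almost_kenmotsu U phi xi eta g,
      smooth_on U kappa, smooth_on U mu &
      exists nabla, levi_civita U g nabla /\
        forall X Y : E -> E, smooth_mx_on U X -> smooth_mx_on U Y ->
        forall x, U x ->
          curvature nabla X Y xi x
          = kappa x *: (form_app eta Y x *: X x - form_app eta X x *: Y x)
            + mu x *: (form_app eta Y x *: h_tensor phi xi X x
                       - form_app eta X x *: h_tensor phi xi Y x)].

End AlmostContact.

Section Construction.
Variable R : realType.

Definition mx22 (p q r s : R) : 'M[R]_2 :=
  \matrix_(i, j) nth 0 (nth [::] [:: [:: p; q]; [:: r; s]] i) j.

Definition M1 : 'M[R]_2 := mx22 1 0 0 (-1).
Definition M2 : 'M[R]_2 := mx22 0 1 (-1) 0.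
Definition M3 : 'M[R]_2 := mx22 0 1 1 0.

Definition lambdabar (t : R) : R := expR (- 2 * t).

Definition is_mx_derive (A : R -> 'M[R]_2) (t : R) (A' : 'M[R]_2) :=
  forall i j, is_derive t (1 : R) (fun s => A s i j) (A' i j).

Record ode_solution (mubar : R -> R) (a b : R) (F H B : R -> 'M[R]_2) : Prop :=
  OdeSolution {
    ode_F : forall t, a < t < b -> is_mx_derive F t (2 *: H t) ;
    ode_H : forall t, a < t < b ->
      is_mx_derive H t
        ((2 * lambdabar t ^+ 2) *: F t - 2 *: H t - mubar t *: B t) ;
    ode_B : forall t, a < t < b ->
      is_mx_derive B t (mubar t *: H t - 2 *: B t) ;
    ode_F0 : F 0 = M2 ;
    ode_H0 : H 0 = M3 ;
    ode_B0 : B 0 = M1 }.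

Local Notation E := 'cV[R]_(1.*2.+1).

(* Coordinate 0 is t, coordinates 1 and 2 are x_1 and x_2. *)
Definition tcoord (x : E) : R := x 0 0.

Definition slab (a b : R) : set E := [set x | a < tcoord x < b].

Definition xi_field : E -> E := fun=> delta_mx 0 0.

Definition eta_form : E -> 'rV[R]_(1.*2.+1) := fun=> delta_mx 0 0.

Definition metric (G : R -> 'M[R]_2) (x : E) : 'M[R]_(1.*2.+1) :=
  block_mx (1%:M : 'M[R]_1) 0 0 (expR (2 * tcoord x) *: G (tcoord x)).

Definition phi_endo (F : R -> 'M[R]_2) (x : E) : 'M[R]_(1.*2.+1) :=
  block_mx (0 : 'M[R]_1) 0 0 (F (tcoord x)).

End Construction.

(* Main.v *)
Require Import Defs.
From HB Require Import structures.
From mathcomp Require Import all_boot all_order all_algebra.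
From mathcomp Require Import all_classical all_reals all_analysis.
From mathcomp Require Import ring lra.
Import Order.TTheory GRing.Theory Num.Theory.
Import numFieldNormedType.Exports.
Local Open Scope classical_set_scope.
Local Open Scope ring_scope.

(** The metric has the form dt^2 + S(t), where S = e^(2t) G depends on t alone,
    so everything reduces to two-by-two matrices depending on t.

    Algebra of the system.  Two solutions of the linear system agree, because
    the energy f^2 + e^(4t) (h^2 + b^2) of a scalar solution (f, h, b) grows at
    a rate at most 4 e^(-2t): mubar enters only through a rotation of (h, b)
    and drops out.  Now the commutators -1/2 e^(4t) [H,B], 1/2 [B,F], 1/2 [F,H]
    solve the same system with the same initial values, hence they are F, H, B
    ([ode_commutators]).  This makes the three matrices traceless.  Then F^2 is
    scalar, so that F H + H F = 1/2 [B, F^2] = 0, so that F^2 is constant; one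
    gets F^2 = -1, F H = B, F B = -H and B^2 = e^(-4t).

    Geometry of the cylinder.  Put A = 1/2 S^-1 S', extended by 0 to the t
    direction.  The connection D_X Y + Gamma(X, Y) with
      Gamma(u, v) = -1/2 S'(u, v) d/dt + dt(u) A v + dt(v) A u
    is torsion-free and metric ([cylinder_connection_levi_civita]), it
    satisfies nabla_X xi = A X, and this gives
      R(X, Y) xi = dt(X) (A' + A^2) Y - dt(Y) (A' + A^2) X
    ([cylinder_curvature_e0]).

    Conclusion.  The algebra gives A = 1 - B, and the equation for B turns
    A' + A^2 into (1 + e^(-4t)) - mubar H ([shape_riccati]); since
    h = 1/2 F' = H, this is the generalized (kappa, mu) condition.  The
    fundamental 2-form has the matrix e^(2t) M2, because G F = M2; hence
    dPhi = 2 dt /\ Phi ([fundamental_form_derive]).  Smoothness holds because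
    the algebra of functions generated by exponentials, derivatives of mubar
    and entries of F, H, B is stable under partial derivatives. *)

Set Implicit Arguments.
Unset Strict Implicit.
Unset Printing Implicit Defensive.

(** * Differential calculus of matrix-valued functions *)

(** The difference g - f vanishes near x, so 0 is its differential there, and
    g = f + (g - f). *)
Lemma differentiable_near_eq {R : numFieldType} {V W : normedModType R}
    (f g : V -> W) (x : V) :
  {near x, f =1 g} -> differentiable f x -> differentiable g x.
Proof.
move=> fg df; have kx : (g - f) x = 0.
  by rewrite /= -[LHS]/(g x - f x) (nbhs_singleton fg) subrr.
have ko : (g - f) \o shift x = cst ((g - f) x) + (0 : V -> W) +o_ 0 id.
  apply/eqaddoP => e e0 /=; rewrite kx.
  have : \forall h \near 0, f (h + x) = g (h + x).
    by have := fg; rewrite [X in X -> _](near_shift 0 x) subr0; apply: filterS.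
  apply: filterS => h fgh.
  rewrite -[X in `|X|]/((g (h + x) - f (h + x)) - (0 + 0)) fgh subrr addr0 subrr.
  by rewrite normr0 mulr_ge0// ltW.
have dk0 : 'd (g - f) x = 0 :> (V -> W).
  by apply: diff_unique => //; exact: cst_continuous.
have dk : differentiable (g - f) x.
  by apply/diff_locallyP; rewrite dk0; split=> //; exact: cst_continuous.
by rewrite -[g](subrK f); exact: differentiableD.
Qed.

Lemma addmx_entry {R : nmodType} {p q : nat} (P Q : 'M[R]_(p, q)) i j :
  (P + Q) i j = P i j + Q i j.
Proof. by rewrite mxE. Qed.

Lemma scalemx_entry {R : pzRingType} {p q : nat} c (P : 'M[R]_(p, q)) i j :
  (c *: P) i j = c * P i j.
Proof. by rewrite mxE. Qed.

Section MatrixCalculus.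
Context {R : realType} {m : nat}.
Local Notation E := 'cV[R]_m.+1.

(** The product rules below are proved entry by entry, so this is the form of
    differentiability that they use. *)
Definition entries_differentiable {p q : nat} (M : E -> 'M[R]_(p, q)) (x : E) :=
  forall i j, differentiable (fun y => M y i j) x.

Lemma derive_entry {p q : nat} (M : E -> 'M[R]_(p, q)) (x v : E) i j :
  entries_differentiable M x -> ('D_v M x) i j = 'D_v (fun y => M y i j) x.
Proof.
move=> dM; rewrite derive_mx ?mxE//.
by apply/derivable_mxP => k l; exact: diff_derivable.
Qed.

Lemma entries_differentiable_cst {p q : nat} (A : 'M[R]_(p, q)) (x : E) :
  entries_differentiable (fun=> A) x.
Proof. by move=> i j; exact: differentiable_cst. Qed.

Lemma entries_differentiableM {p q r : nat} (M : E -> 'M[R]_(p, q))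
    (N : E -> 'M[R]_(q, r)) x :
  entries_differentiable M x -> entries_differentiable N x ->
  entries_differentiable (fun y => M y *m N y) x.
Proof.
move=> dM dN i j.
have -> : (fun y => (M y *m N y) i j)
    = \sum_k ((fun y => M y i k) * (fun y => N y k j)).
  by apply/funext => y; rewrite mxE fct_sumE.
by apply: differentiable_sum => k; exact: differentiableM.
Qed.

Lemma entries_differentiableT {p q : nat} (M : E -> 'M[R]_(p, q)) x :
  entries_differentiable M x -> entries_differentiable (fun y => (M y)^T) x.
Proof.
move=> dM i j; rewrite (_ : (fun y => _) = fun y => M y j i)//.
by apply/funext => y; rewrite mxE.
Qed.

Lemma derive_mulmx {p q r : nat} (M : E -> 'M[R]_(p, q))
    (N : E -> 'M[R]_(q, r)) x v :
  entries_differentiable M x -> entries_differentiable N x ->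
  'D_v (fun y => M y *m N y) x = 'D_v M x *m N x + M x *m 'D_v N x.
Proof.
move=> dM dN; apply/matrixP => i j.
rewrite derive_entry; last exact: entries_differentiableM.
have -> : (fun y => (M y *m N y) i j)
    = \sum_k ((fun y => M y i k) * (fun y => N y k j)).
  by apply/funext => y; rewrite mxE fct_sumE.
rewrite derive_sum; last first.
  by move=> k; apply: derivableM; exact: diff_derivable.
rewrite !mxE -big_split/=; apply: eq_bigr => k _.
rewrite deriveM; [|exact: diff_derivable..].
rewrite (derive_entry v i k dM) (derive_entry v k j dN) addrC; congr (_ + _).
by rewrite mulrC.
Qed.

Lemma derive_trmx {p q : nat} (M : E -> 'M[R]_(p, q)) x v :
  entries_differentiable M x -> 'D_v (fun y => (M y)^T) x = ('D_v M x)^T.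
Proof.
move=> dM; apply/matrixP => i j.
have -> : ('D_v M x)^T i j = ('D_v M x) j i by rewrite mxE.
rewrite (derive_entry v i j (entries_differentiableT dM)) derive_entry//.
by rewrite (_ : (fun y => _) = fun y => M y j i)//; apply/funext => y; rewrite mxE.
Qed.

Lemma derive_bilin (g : E -> 'M[R]_m.+1) (X Y : E -> E) x v :
  entries_differentiable g x -> entries_differentiable X x ->
  entries_differentiable Y x ->
  'D_v (bilin_app g X Y) x = bilin ('D_v g x) (X x) (Y x)
    + bilin (g x) ('D_v X x) (Y x) + bilin (g x) (X x) ('D_v Y x).
Proof.
move=> dg dX dY; have dXT := entries_differentiableT dX.
have dXg := entries_differentiableM dXT dg.
have dXgY := entries_differentiableM dXg dY.
rewrite /bilin_app /bilin -(derive_entry v 0 0 dXgY) derive_mulmx// derive_mulmx//.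
by rewrite derive_trmx// mulmxDl !addmx_entry [X in X + _]addrC.
Qed.

Lemma derive_dirD (f : E -> R) x u v : differentiable f x ->
  'D_(u + v) f x = 'D_u f x + 'D_v f x.
Proof. by move=> df; rewrite !deriveE// linearD. Qed.

Lemma derive_dirZ (f : E -> R) x c v : differentiable f x ->
  'D_(c *: v) f x = c * 'D_v f x.
Proof. by move=> df; rewrite !deriveE// linearZ. Qed.

Lemma derive_mx_dirD {p q : nat} (M : E -> 'M[R]_(p, q)) x u v :
  entries_differentiable M x -> 'D_(u + v) M x = 'D_u M x + 'D_v M x.
Proof.
move=> dM; apply/matrixP => i j.
apply: etrans (derive_entry (u + v) i j dM) _; rewrite derive_dirD// addmx_entry.
by congr (_ + _); apply: esym; [exact: derive_entry u i j dM|exact: derive_entry v i j dM].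
Qed.

Lemma derive_mx_dirZ {p q : nat} (M : E -> 'M[R]_(p, q)) x c v :
  entries_differentiable M x -> 'D_(c *: v) M x = c *: 'D_v M x.
Proof.
move=> dM; apply/matrixP => i j.
apply: etrans (derive_entry (c *: v) i j dM) _; rewrite derive_dirZ// scalemx_entry.
by congr (c * _); exact: esym (derive_entry v i j dM).
Qed.

Lemma derive_addmx {p q : nat} (M N : E -> 'M[R]_(p, q)) x v :
  entries_differentiable M x -> entries_differentiable N x ->
  'D_v (fun y => M y + N y) x = 'D_v M x + 'D_v N x.
Proof.
move=> dM dN; apply: (@deriveD _ _ _ M N);
  by apply/derivable_mxP => i j; exact: diff_derivable.
Qed.

Lemma derive_scalemx {p q : nat} (f : E -> R) (M : E -> 'M[R]_(p, q)) x v :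
  differentiable f x -> entries_differentiable M x ->
  'D_v (fun y => f y *: M y) x = 'D_v f x *: M x + f x *: 'D_v M x.
Proof.
move=> df dM; apply/matrixP => i j.
have fM : (fun y => (f y *: M y) i j) = f * (fun y => M y i j).
  by apply/funext => y; rewrite mxE.
have dfM : entries_differentiable (fun y => f y *: M y) x.
  move=> k l; rewrite (_ : (fun y => _) = f * (fun y => M y k l)).
    exact: differentiableM.
  by apply/funext => y; rewrite mxE.
rewrite (derive_entry v i j dfM) fM deriveM; [|exact: diff_derivable..].
rewrite -(derive_entry v i j dM) !mxE addrC; congr (_ + _).
by rewrite mulrC.
Qed.

Lemma derive_coordinates (f : E -> R) x v : differentiable f x ->
  'D_v f x = \sum_i v i 0 * partial i f x.
Proof.
move=> df; rewrite deriveE// {1}(matrix_sum_delta v) linear_sum.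
apply: eq_bigr => i _; rewrite big_ord1 linearZ /=.
by rewrite /partial deriveE.
Qed.

End MatrixCalculus.

(** * Algebras of smooth functions on an open set *)

Section SmoothFunctions.
Context {R : realType} {m : nat}.
Local Notation E := 'cV[R]_m.+1.
Variable U : set E.
Hypothesis openU : open U.
Implicit Types (f g : E -> R) (Q : (E -> R) -> Prop).

(** The algebra generated by Q and the constants, saturated under equality on U.
    Saturation is needed because partial derivatives are known only at the
    points of U, although functions are total. *)
Inductive generated Q : (E -> R) -> Prop :=
| generated_base f of Q f : generated Q f
| generated_cst c : generated Q (cst c)
| generated_add f g of generated Q f & generated Q g :
    generated Q (fun x => f x + g x)
| generated_mul f g of generated Q f & generated Q g :
    generated Q (fun x => f x * g x)
| generated_ext f g of generated Q f & (forall x, U x -> f x = g x) :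
    generated Q g.

Lemma near_eq_on f g x : U x -> (forall y, U y -> f y = g y) ->
  {near x, f =1 g}.
Proof. by move=> Ux fg; move: (open_nbhs_nbhs (conj openU Ux)); apply: filterS. Qed.

Lemma eq_derive_on (W : normedModType R) (f g : E -> W) x v :
  U x -> (forall y, U y -> f y = g y) -> 'D_v f x = 'D_v g x.
Proof.
move=> Ux fg; apply: near_eq_derive.
by move: (open_nbhs_nbhs (conj openU Ux)); apply: filterS.
Qed.

(** Stability under partial derivatives passes from generators to the algebra
    by the sum and product rules; on U, which is open, equal functions have
    equal derivatives. *)
Lemma generated_partial Q :
  (forall f, Q f -> (forall x, U x -> differentiable f x) /\
                    (forall i, generated Q (partial i f))) ->
  forall f, generated Q f -> (forall x, U x -> differentiable f x) /\
                    (forall i, generated Q (partial i f)).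
Proof.
move=> baseQ f; elim=> {f}.
- exact: baseQ.
- move=> c; split=> [x _|i]; first exact: differentiable_cst.
  apply: generated_ext (generated_cst _ 0) _ => x _.
  by rewrite /partial derive_cst.
- move=> f g gf [df pf] gg [dg pg]; split=> [x Ux|i].
    by apply: differentiableD; [exact: df|exact: dg].
  apply: generated_ext (generated_add (pf i) (pg i)) _ => x Ux.
  by rewrite /partial (@deriveD _ _ _ f g)//; apply: diff_derivable; auto.
- move=> f g gf [df pf] gg [dg pg]; split=> [x Ux|i].
    by apply: differentiableM; [exact: df|exact: dg].
  apply: (generated_ext (generated_add (generated_mul gf (pg i))
                                       (generated_mul gg (pf i)))) => x Ux.
  by rewrite /partial (@deriveM _ _ f g)//; apply: diff_derivable; auto.
- move=> f g gf [df pf] fg; split=> [x Ux|i].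
    exact: differentiable_near_eq (near_eq_on Ux fg) (df x Ux).
  apply: generated_ext (pf i) _ => x Ux.
  exact: eq_derive_on.
Qed.

(** To prove smoothness it is enough to exhibit an algebra of differentiable
    functions stable under the partial derivatives: no induction on the order
    of differentiation has to be done for each function. *)
Lemma generated_smooth Q :
  (forall f, Q f -> (forall x, U x -> differentiable f x) /\
                    (forall i, generated Q (partial i f))) ->
  forall f, generated Q f -> smooth_on U f.
Proof.
move=> baseQ f Qf s; apply: (generated_partial baseQ _).1.
by elim: s => //= i s IHs; apply: (generated_partial baseQ _).2.
Qed.

Lemma smooth_partial f i : smooth_on U f -> smooth_on U (partial i f).
Proof. by move=> sf s x Ux; have := sf (rcons s i) x Ux; rewrite foldr_rcons. Qed.

Lemma smooth_differentiable f x : smooth_on U f -> U x -> differentiable f x.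
Proof. by move=> sf Ux; exact: (sf [::]). Qed.

(** With the smooth functions themselves as generators, this yields all the
    closure properties that follow. *)
Lemma generated_smooth_on f : generated (smooth_on U) f -> smooth_on U f.
Proof.
apply: generated_smooth => {}f sf; split=> [x|i].
  exact: smooth_differentiable.
exact/generated_base/smooth_partial.
Qed.

Lemma smooth_cst c : smooth_on U (cst c).
Proof. exact/generated_smooth_on/generated_cst. Qed.

Lemma smooth_add f g : smooth_on U f -> smooth_on U g ->
  smooth_on U (fun x => f x + g x).
Proof.
by move=> sf sg; apply/generated_smooth_on/generated_add; exact: generated_base.
Qed.

Lemma smooth_mul f g : smooth_on U f -> smooth_on U g ->
  smooth_on U (fun x => f x * g x).
Proof.
by move=> sf sg; apply/generated_smooth_on/generated_mul; exact: generated_base.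
Qed.

Lemma smooth_ext f g : smooth_on U f -> (forall x, U x -> f x = g x) ->
  smooth_on U g.
Proof.
by move=> sf; move/generated_ext => e; apply/generated_smooth_on/e/generated_base.
Qed.

Lemma smooth_sum n (f : 'I_n -> E -> R) : (forall k, smooth_on U (f k)) ->
  smooth_on U (fun x => \sum_k f k x).
Proof.
elim: n f => [|n IHn] f sf.
  by apply: smooth_ext (smooth_cst 0) _ => x _; rewrite big_ord0.
apply: smooth_ext (smooth_add (sf ord0) (IHn (fun k => f (lift ord0 k)) _)) _ => //.
by move=> x _; rewrite big_ord_recl.
Qed.

Lemma smooth_mx_differentiable p q (M : E -> 'M[R]_(p, q)) x :
  smooth_mx_on U M -> U x -> entries_differentiable M x.
Proof. by move=> sM Ux i j; exact: smooth_differentiable. Qed.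

Lemma smooth_mx_cst p q (A : 'M[R]_(p, q)) : smooth_mx_on U (fun=> A).
Proof. by move=> i j; exact: smooth_cst. Qed.

Lemma smooth_mx_add p q (M N : E -> 'M[R]_(p, q)) :
  smooth_mx_on U M -> smooth_mx_on U N -> smooth_mx_on U (fun x => M x + N x).
Proof.
move=> sM sN i j; apply: smooth_ext (smooth_add (sM i j) (sN i j)) _ => x _.
by rewrite mxE.
Qed.

Lemma smooth_mx_scale p q f (M : E -> 'M[R]_(p, q)) :
  smooth_on U f -> smooth_mx_on U M -> smooth_mx_on U (fun x => f x *: M x).
Proof.
move=> sf sM i j; apply: smooth_ext (smooth_mul sf (sM i j)) _ => x _.
by rewrite mxE.
Qed.

Lemma smooth_mx_mul p q r (M : E -> 'M[R]_(p, q)) (N : E -> 'M[R]_(q, r)) :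
  smooth_mx_on U M -> smooth_mx_on U N -> smooth_mx_on U (fun x => M x *m N x).
Proof.
move=> sM sN i j.
apply: smooth_ext (smooth_sum (fun k => smooth_mul (sM i k) (sN k j))) _ => x _.
by rewrite mxE.
Qed.

Lemma smooth_mx_tr p q (M : E -> 'M[R]_(p, q)) :
  smooth_mx_on U M -> smooth_mx_on U (fun x => (M x)^T).
Proof. by move=> sM i j; apply: smooth_ext (sM j i) _ => x _; rewrite mxE. Qed.

(** In coordinates, D_X M is the sum of the products of the components of X with
    the partial derivatives of M. *)
Lemma smooth_mx_derive p q (X : E -> E) (M : E -> 'M[R]_(p, q)) :
  smooth_mx_on U X -> smooth_mx_on U M ->
  smooth_mx_on U (fun x => 'D_(X x) M x).
Proof.
move=> sX sM i j.
apply: smooth_ext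
  (smooth_sum (fun k => smooth_mul (sX k 0) (smooth_partial k (sM i j)))) _.
move=> x Ux; rewrite derive_entry; last exact: smooth_mx_differentiable.
by rewrite -derive_coordinates//; exact: smooth_differentiable.
Qed.

End SmoothFunctions.

(** * Connection and curvature of a metric dt^2 + S(t) *)

Section BilinearForms.
Context {R : realType} {m : nat}.
Local Notation E := 'cV[R]_m.+1.
Implicit Types (g A : 'M[R]_m.+1) (u v w : E) (c : R).

Lemma bilinDl g u v w : bilin g (u + v) w = bilin g u w + bilin g v w.
Proof. by rewrite /bilin linearD/= !mulmxDl mxE. Qed.

Lemma bilinDr g u v w : bilin g u (v + w) = bilin g u v + bilin g u w.
Proof. by rewrite /bilin mulmxDr mxE. Qed.

Lemma bilinZl g c u v : bilin g (c *: u) v = c * bilin g u v.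
Proof. by rewrite /bilin linearZ/= -!scalemxAl mxE. Qed.

Lemma bilinZr g c u v : bilin g u (c *: v) = c * bilin g u v.
Proof. by rewrite /bilin -scalemxAr mxE. Qed.

Lemma bilin_mxZ g c u v : bilin (c *: g) u v = c * bilin g u v.
Proof. by rewrite /bilin -scalemxAr -scalemxAl mxE. Qed.

Lemma bilin_mxD g A u v : bilin (g + A) u v = bilin g u v + bilin A u v.
Proof. by rewrite /bilin mulmxDr mulmxDl mxE. Qed.

Lemma bilin_tr g u v : bilin g^T u v = bilin g v u.
Proof.
have trE (P : 'M[R]_1) : P 0 0 = P^T 0 0 by rewrite mxE.
by rewrite /bilin trE !trmx_mul !trmxK mulmxA.
Qed.

Lemma bilin_mulr g A u v : bilin g u (A *m v) = bilin (g *m A) u v.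
Proof. by rewrite /bilin !mulmxA. Qed.

Lemma bilin_mull g A u v : bilin g (A *m u) v = bilin (A^T *m g) u v.
Proof. by rewrite /bilin trmx_mul !mulmxA. Qed.

Lemma bilin_delta g u v : g *m u = v -> forall w, bilin g w u = (w^T *m v) 0 0.
Proof. by move=> gu w; rewrite /bilin -mulmxA gu. Qed.

End BilinearForms.

Section CylinderConnection.
Context {R : realType} {m : nat}.
Local Notation E := 'cV[R]_m.+1.
Local Notation e0 := (delta_mx 0 0 : E).
Implicit Types (x u v w : E) (X Y Z : E -> E).
Variables (U : set E) (S S1 A A1 : E -> 'M[R]_m.+1).
Hypotheses (openU : open U).
Hypotheses (smoothS : smooth_mx_on U S) (smoothS1 : smooth_mx_on U S1)
  (smoothA : smooth_mx_on U A).
Hypotheses (symS : forall x, U x -> (S x)^T = S x)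
  (symS1 : forall x, U x -> (S1 x)^T = S1 x).
Hypotheses (derS : forall x (v : E), U x -> 'D_v S x = v 0 0 *: S1 x)
  (derA : forall x (v : E), U x -> 'D_v A x = v 0 0 *: A1 x).
Hypotheses (S_e0 : forall x, U x -> S x *m e0 = e0)
  (A_e0 : forall x, U x -> A x *m e0 = 0)
  (S_A : forall x, U x -> S x *m A x = 2^-1 *: S1 x).

(** The Christoffel symbols of a metric S with S1 = dS/dt, in which A stands for
    the endomorphism 1/2 S^-1 S1, that is, the shape operator of the slices
    t = constant. *)
Definition cylinder_christoffel (x u v : E) : E :=
  (- 2^-1 * bilin (S1 x) u v) *: e0
  + (u 0 0 *: (A x *m v) + v 0 0 *: (A x *m u)).

Definition cylinder_connection (X Y : E -> E) : E -> E :=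
  fun x => 'D_(X x) Y x + cylinder_christoffel x (X x) (Y x).

(** The equation S A = 1/2 S1 forces S1 to degenerate wherever A does. *)
Let S1_e0 x : U x -> S1 x *m e0 = 0.
Proof.
move=> Ux; have := congr1 (mulmx^~ e0) (S_A Ux).
rewrite /= -mulmxA A_e0// mulmx0 -scalemxAl => /esym/eqP.
by rewrite scaler_eq0 invr_eq0 pnatr_eq0/= => /eqP.
Qed.

Let e0_A x : U x -> e0^T *m A x = 0.
Proof.
move=> Ux; rewrite -[in LHS](S_e0 Ux) trmx_mul symS// -mulmxA S_A//.
by rewrite -scalemxAr -[S1 x]symS1// -trmx_mul S1_e0// trmx0 scaler0.
Qed.

(** S preserves e0, so A takes its values in the slices t = constant. *)
Let A_time x u : U x -> (A x *m u : E) 0 0 = 0.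
Proof.
move=> Ux; have := congr1 (fun M : 'rV[R]_m.+1 => (M *m u) 0 0) (e0_A Ux).
by rewrite mul0mx [RHS]mxE -mulmxA trmx_delta -rowE mxE.
Qed.

Let bilin_e0 x u : U x -> bilin (S x) u e0 = u 0 0.
Proof.
move=> Ux; rewrite (bilin_delta (S_e0 Ux)).
by rewrite -colE !mxE.
Qed.

Let bilin_SA x u v : U x -> bilin (S x) u (A x *m v) = 2^-1 * bilin (S1 x) u v.
Proof. by move=> Ux; rewrite bilin_mulr S_A// bilin_mxZ. Qed.

Let bilinSC x u v : U x -> bilin (S x) u v = bilin (S x) v u.
Proof. by move=> Ux; rewrite -[S x in LHS]symS// bilin_tr. Qed.

Let bilinS1C x u v : U x -> bilin (S1 x) u v = bilin (S1 x) v u.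
Proof. by move=> Ux; rewrite -[S1 x in LHS]symS1// bilin_tr. Qed.

Lemma christoffelC x u v : U x ->
  cylinder_christoffel x u v = cylinder_christoffel x v u.
Proof.
by move=> Ux; rewrite /cylinder_christoffel bilinS1C// [X in _ + X]addrC.
Qed.

(** The left side is the derivative of S in the direction v, evaluated on u and
    w.  Since S(A u, w) = 1/2 S1(u, w) and S(e0, w) = dt(w), the terms with
    dt(u) and dt(w) cancel, and the two terms with dt(v) add up. *)
Lemma christoffel_metric x u v w : U x ->
  v 0 0 * bilin (S1 x) u w = bilin (S x) (cylinder_christoffel x v u) w
                           + bilin (S x) u (cylinder_christoffel x v w).
Proof.
move=> Ux; rewrite (bilinSC _ w)// /cylinder_christoffel.
rewrite !bilinDr !bilinZr !bilin_e0// !bilin_SA//.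
by rewrite (bilinS1C w u)// (bilinS1C w v)// (bilinS1C u v)//; field.
Qed.

Lemma christoffelDr x u v v' :
  cylinder_christoffel x u (v + v')
  = cylinder_christoffel x u v + cylinder_christoffel x u v'.
Proof.
rewrite /cylinder_christoffel bilinDr mxE mulmxDr mulrDr !scalerDr !scalerDl.
by rewrite [RHS]addrACA; congr (_ + _); exact: addrACA.
Qed.

Lemma christoffelZr x c u v :
  cylinder_christoffel x u (c *: v) = c *: cylinder_christoffel x u v.
Proof.
rewrite /cylinder_christoffel bilinZr mxE -scalemxAr !scalerDr !scalerA.
by rewrite mulrCA [c * u 0 0]mulrC.
Qed.

Lemma christoffelDl x u u' v : U x ->
  cylinder_christoffel x (u + u') v
  = cylinder_christoffel x u v + cylinder_christoffel x u' v.
Proof.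
by move=> Ux; rewrite christoffelC// christoffelDr; congr (_ + _);
  exact: christoffelC.
Qed.

Lemma christoffelZl x c u v : U x ->
  cylinder_christoffel x (c *: u) v = c *: cylinder_christoffel x u v.
Proof.
by move=> Ux; rewrite christoffelC// christoffelZr; congr (_ *: _);
  exact: christoffelC.
Qed.

Lemma smooth_bilin (g : E -> 'M[R]_m.+1) X Y :
  smooth_mx_on U g -> smooth_mx_on U X -> smooth_mx_on U Y ->
  smooth_on U (bilin_app g X Y).
Proof.
move=> sg sX sY; apply: smooth_mx_mul => //.
by apply: smooth_mx_mul => //; exact: smooth_mx_tr.
Qed.

Lemma smooth_christoffel X Y : smooth_mx_on U X -> smooth_mx_on U Y ->
  smooth_mx_on U (fun x => cylinder_christoffel x (X x) (Y x)).
Proof.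
move=> sX sY; have sAX := smooth_mx_mul openU smoothA sX.
have sAY := smooth_mx_mul openU smoothA sY.
apply: smooth_mx_add => //; last first.
  by apply: smooth_mx_add => //; exact: smooth_mx_scale.
apply: smooth_mx_scale => //; last exact: smooth_mx_cst.
apply: smooth_mul => //; first exact: smooth_cst.
exact: smooth_bilin.
Qed.

Lemma cylinder_connection_affine : affine_connection U cylinder_connection.
Proof.
split.
- move=> X X' Y Y' sX sX' sY sY' XX' YY' x Ux.
  rewrite /cylinder_connection (eq_derive_on openU (X x) Ux YY').
  by rewrite (XX' x Ux) (YY' x Ux).
- move=> X Y sX sY; apply: smooth_mx_add => //.
    exact: smooth_mx_derive.
  exact: smooth_christoffel.
- move=> X X' Y sX sX' sY x Ux; rewrite /cylinder_connection.
  rewrite derive_mx_dirD; last exact: smooth_mx_differentiable sY Ux.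
  by rewrite christoffelDl// addrACA.
- move=> f X Y sf sX sY x Ux; rewrite /cylinder_connection.
  rewrite derive_mx_dirZ; last exact: smooth_mx_differentiable sY Ux.
  by rewrite christoffelZl// [RHS]scalerDr.
- move=> X Y Y' sX sY sY' x Ux; rewrite /cylinder_connection.
  rewrite christoffelDr derive_addmx; first exact: addrACA.
    exact: smooth_mx_differentiable sY Ux.
  exact: smooth_mx_differentiable sY' Ux.
- move=> f X Y sf sX sY x Ux; rewrite /cylinder_connection.
  rewrite christoffelZr derive_scalemx; first by rewrite [X in _ = _ + X]scalerDr addrA.
    exact: smooth_differentiable sf Ux.
  exact: smooth_mx_differentiable sY Ux.
Qed.

Lemma cylinder_connection_levi_civita : levi_civita U S cylinder_connection.
Proof.
split; first exact: cylinder_connection_affine.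
- move=> X Y sX sY x Ux; rewrite /cylinder_connection christoffelC//.
  by rewrite opprD [LHS]addrACA subrr addr0.
- move=> X Y Z sX sY sZ x Ux; rewrite /vfield_derive.
  have dif := smooth_mx_differentiable.
  rewrite derive_bilin; [|exact: dif Ux..].
  rewrite derS// bilin_mxZ christoffel_metric// /bilin_app /cylinder_connection.
  rewrite (bilinDl _ ('D_(X x) Y x)) (bilinDr _ (Y x) ('D_(X x) Z x)).
  by rewrite -addrA addrC addrACA.
Qed.

(** Both S1 and A annihilate e0, so of Gamma only the term with dt(e0) = 1 is left. *)
Lemma connection_e0 X x : U x ->
  cylinder_connection X (fun=> e0) x = A x *m X x.
Proof.
move=> Ux; rewrite /cylinder_connection derive_cst add0r /cylinder_christoffel.
rewrite (bilin_delta (S1_e0 Ux)) mulmx0 A_e0// !mxE mulr0 scale0r scaler0.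
by rewrite scale1r !add0r.
Qed.

(** Expand nabla_X (A Y) - nabla_Y (A X) - A [X,Y].  The derivatives of X and Y
    cancel against the bracket; the d/dt components cancel because S1 A = 2 S A^2
    is symmetric. *)
Lemma cylinder_curvature_e0 X Y x : smooth_mx_on U X -> smooth_mx_on U Y -> U x ->
  curvature cylinder_connection X Y (fun=> e0) x
  = X x 0 0 *: ((A1 x + A x *m A x) *m Y x)
    - Y x 0 0 *: ((A1 x + A x *m A x) *m X x).
Proof.
move=> sX sY Ux.
have dX := smooth_mx_differentiable sX Ux.
have dY := smooth_mx_differentiable sY Ux.
have dA := smooth_mx_differentiable smoothA Ux.
have nab Z W : smooth_mx_on U Z -> smooth_mx_on U W ->
    cylinder_connection Z (cylinder_connection W (fun=> e0)) x
    = Z x 0 0 *: (A1 x *m W x) + A x *m 'D_(Z x) W x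
      + cylinder_christoffel x (Z x) (A x *m W x).
  move=> sZ sW; have sAW := smooth_mx_mul openU smoothA sW.
  rewrite (connection_restr cylinder_connection_affine
            (X' := Z) (Y' := fun y => A y *m W y))//.
  - rewrite /cylinder_connection derive_mulmx//; last first.
      exact: smooth_mx_differentiable sW Ux.
    by rewrite derA// scalemxAl.
  - apply: (connection_smooth cylinder_connection_affine) => //.
    exact: smooth_mx_cst.
  - by move=> y Uy; exact: connection_e0.
rewrite /curvature !nab// connection_e0// /lie_bracket mulmxBr.
have chr Z W : cylinder_christoffel x (Z x) (A x *m W x)
    = (- 2^-1 * bilin (S1 x *m A x) (Z x) (W x)) *: e0
      + Z x 0 0 *: (A x *m A x *m W x).
  by rewrite /cylinder_christoffel bilin_mulr A_time// scale0r addr0 mulmxA.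
(* S1 A is twice A^T S A. *)
have symSA : (S1 x *m A x)^T = S1 x *m A x.
  have -> : S1 x = 2 *: (S x *m A x).
    by rewrite S_A// scalerA mulfV ?scale1r// pnatr_eq0.
  rewrite -scalemxAl linearZ/=; congr (_ *: _).
  have SAT : (S x *m A x)^T = S x *m A x by rewrite S_A// linearZ/= symS1.
  by rewrite trmx_mul SAT -{1}symS// mulmxA -trmx_mul SAT.
rewrite !chr -{2}symSA bilin_tr !mulmxDl !scalerDr.
have cancel (p q r s c d e : E) :
    p + d + (c + r) - (q + e + (c + s)) - (d - e) = p + r - (q + s).
  by apply/matrixP => i j; rewrite !mxE; ring.
exact: cancel.
Qed.

End CylinderConnection.

(** * Exterior derivatives and Lie derivatives *)

Section FormsAndLieDerivatives.
Context {R : realType} {m : nat}.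
Local Notation E := 'cV[R]_m.+1.
Implicit Types (X Y Z : E -> E) (x w : E).

Lemma ext_derivative1_cst (c : 'rV[R]_m.+1) X Y x :
  entries_differentiable X x -> entries_differentiable Y x ->
  ext_derivative1 (form_app (fun=> c)) X Y x = 0.
Proof.
have der Z v : entries_differentiable Z x ->
    'D_v (form_app (fun=> c) Z) x = (c *m 'D_v Z x) 0 0.
  move=> dZ; have dc := entries_differentiable_cst c x.
  rewrite -(derive_entry v 0 0 (entries_differentiableM dc dZ)) derive_mulmx//.
  by rewrite derive_cst mul0mx add0r.
move=> dX dY; rewrite /ext_derivative1 /vfield_derive !der//.
rewrite /form_app /lie_bracket mulmxBr.
have subE (P Q : 'M[R]_1) : (P - Q) 0 0 = P 0 0 - Q 0 0 by rewrite !mxE.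
by rewrite subE subrr.
Qed.

Lemma bilinBl (g : 'M[R]_m.+1) (u v w : E) :
  bilin g (u - v) w = bilin g u w - bilin g v w.
Proof. by rewrite bilinDl -scaleN1r bilinZl mulN1r. Qed.

(** In each term of the Leibniz rule a field is differentiated along another one;
    by skew-symmetry these pair up into the brackets, so only the derivatives
    of the coefficients survive. *)
Lemma ext_derivative2_bilin (Om : E -> 'M[R]_m.+1) X Y Z x :
  entries_differentiable Om x -> (Om x)^T = - Om x ->
  entries_differentiable X x -> entries_differentiable Y x ->
  entries_differentiable Z x ->
  ext_derivative2 (bilin_app Om) X Y Z x
  = bilin ('D_(X x) Om x) (Y x) (Z x) + bilin ('D_(Y x) Om x) (Z x) (X x)
    + bilin ('D_(Z x) Om x) (X x) (Y x).
Proof.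
move=> dOm skew dX dY dZ.
have skewC u v : bilin (Om x) u v = - bilin (Om x) v u.
  by rewrite -bilin_tr skew -scaleN1r bilin_mxZ mulN1r.
rewrite /ext_derivative2 /vfield_derive !derive_bilin// /bilin_app /lie_bracket.
move: ('D_(X x) Y x) ('D_(X x) Z x) ('D_(Y x) X x) ('D_(Y x) Z x)
  ('D_(Z x) X x) ('D_(Z x) Y x) => XY XZ YX YZ ZX ZY.
rewrite (bilinBl _ XY) (bilinBl _ YZ) (bilinBl _ ZX).
rewrite (skewC (Y x) XZ) (skewC (Z x) YX) (skewC (X x) ZY).
by ring.
Qed.

Lemma lie_derivative_endo_cst (w : E) (phi : E -> 'M[R]_m.+1) X x :
  entries_differentiable phi x -> entries_differentiable X x ->
  lie_derivative_endo (fun=> w) phi X x = 'D_w phi x *m X x.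
Proof.
move=> dphi dX; rewrite /lie_derivative_endo /lie_bracket /endo_app.
by rewrite !derive_cst !subr0 derive_mulmx// addrK.
Qed.

End FormsAndLieDerivatives.

(** * Functions of one variable and Gronwall's argument *)

Section OneVariable.
Context {R : realType}.
Implicit Types (f g : R -> R) (t c : R).

Lemma is_derive1_add f g t df dg :
  is_derive t 1 f df -> is_derive t 1 g dg ->
  is_derive t 1 (fun s => f s + g s) (df + dg).
Proof. by move=> hf hg; exact: is_deriveD. Qed.

Lemma is_derive1_mul f g t df dg :
  is_derive t 1 f df -> is_derive t 1 g dg ->
  is_derive t 1 (fun s => f s * g s) (df * g t + f t * dg).
Proof.
move=> hf hg; apply: (is_derive_eq (is_deriveM hf hg)).
by rewrite addrC; congr (_ + _); exact: mulrC.
Qed.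

Lemma is_derive1_scale c f t df :
  is_derive t 1 f df -> is_derive t 1 (fun s => c * f s) (c * df).
Proof. by move=> hf; exact: is_deriveZ. Qed.

Lemma is_derive1_expR f t df :
  is_derive t 1 f df -> is_derive t 1 (fun s => expR (f s)) (df * expR (f t)).
Proof.
move=> hf; apply: (is_derive_eq (is_derive1_comp (is_derive_expR (f t)) hf)).
exact: mulrC.
Qed.

Lemma is_derive1_expRZ c t :
  is_derive t 1 (fun s => expR (c * s)) (c * expR (c * t)).
Proof.
apply: is_derive1_expR; apply: (is_derive_eq (is_derive1_scale c (is_derive_id t 1))).
by rewrite mulr1.
Qed.

(** The weighted function N e^(-K) is nonincreasing to the right of 0, and
    N e^K is nondecreasing to the left of 0. *)
Lemma gronwall_vanish (N dN K k : R -> R) (a b : R) : a < 0 -> 0 < b ->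
  (forall t, a < t < b -> is_derive t 1 N (dN t)) ->
  (forall t, a < t < b -> is_derive t 1 K (k t)) ->
  (forall t, a < t < b -> `|dN t| <= k t * N t) ->
  N 0 = 0 -> forall t, a < t < b -> N t <= 0.
Proof.
move=> a0 b0 hN hK bound N0 t tab.
(* Both weights at once: sg = 1 is used to the right of 0, sg = -1 to the left. *)
pose W (sg s : R) := N s * expR (- sg * K s).
pose dW (sg s : R) := (dN s - sg * k s * N s) * expR (- sg * K s).
have hW sg s : a < s < b -> is_derive s 1 (W sg) (dW sg s).
  move=> sab; apply: is_derive_eq.
    apply: is_derive1_mul (hN s sab) _.
    exact: is_derive1_expR (is_derive1_scale (- sg) (hK s sab)).
  by rewrite /dW; ring.
have mvt sg x y : a < x -> x < y -> y < b ->
    exists2 c, a < c < b & W sg y - W sg x = dW sg c * (y - x).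
  move=> ax xy yb; have inab z : z \in `[x, y]%R -> a < z < b.
    by rewrite in_itv/= => /andP[xz zy]; rewrite (lt_le_trans ax)// (le_lt_trans zy).
  have [z zxy ->] := @MVT R (W sg) (dW sg) x y xy
      (fun z zxy => hW sg z (inab z (subset_itv_oo_cc zxy)))
      (derivable_within_continuous (fun z zxy => @ex_derive _ _ _ _ _ _ _ (hW sg z (inab z zxy)))).
  by exists z => //; exact/inab/subset_itv_oo_cc.
have W0 sg : W sg 0 = 0 by rewrite /W N0 mul0r.
have Wle sg : W sg t <= 0 -> N t <= 0 by rewrite pmulr_lle0// expR_gt0.
have [t0|t0|->] := ltgtP t 0; last by rewrite N0.
- have [c cab] := mvt (-1) t 0 (andP tab).1 t0 b0.
  rewrite W0 sub0r => e; apply: (Wle (-1)); rewrite -oppr_ge0 e.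
  apply: mulr_ge0; last by rewrite subr_ge0 ltW.
  rewrite /dW mulr_ge0 ?expR_ge0//.
  by have := bound c cab; rewrite ler_norml => /andP[+ _]; lra.
- have [c cab] := mvt 1 0 t a0 t0 (andP tab).2.
  rewrite W0 subr0 => e; apply: (Wle 1); rewrite e.
  apply: mulr_le0_ge0; last by rewrite subr0 ltW.
  rewrite /dW mulr_le0_ge0 ?expR_ge0//.
  by have := bound c cab; rewrite ler_norml => /andP[_ +]; lra.
Qed.

End OneVariable.

Section TwoByTwoMatrices.
Context {R : realType}.
Implicit Types (X Y : 'M[R]_2).

(** Case analysis that exposes the indices as the numerals 0 and 1. *)
Lemma ord2P (P : 'I_2 -> Prop) : P 0 -> P 1 -> forall i, P i.
Proof.
move=> P0 P1 [[|[|k]] lt_k2] //.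
- by rewrite (_ : Ordinal _ = 0)//; apply: val_inj.
- by rewrite (_ : Ordinal _ = 1)//; apply: val_inj.
Qed.

Lemma sum_ord2 (f : 'I_2 -> R) : \sum_k f k = f 0 + f 1.
Proof. by rewrite big_ord_recl big_ord1; congr (_ + f _); apply: val_inj. Qed.

Lemma mulmx2E X Y i j : (X *m Y) i j = X i 0 * Y 0 j + X i 1 * Y 1 j.
Proof. by rewrite mxE sum_ord2. Qed.

Lemma mxtrace2 X : \tr X = X 0 0 + X 1 1.
Proof. by rewrite /mxtrace sum_ord2. Qed.

Lemma traceless_entry X : \tr X = 0 -> X 1 1 = - X 0 0.
Proof. by rewrite mxtrace2 addrC => /eqP; rewrite addr_eq0 => /eqP. Qed.

(** The Cayley-Hamilton theorem. *)
Lemma traceless_sqr X : \tr X = 0 -> X *m X = (X 0 0 ^+ 2 + X 0 1 * X 1 0)%:M.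
Proof.
move=> /traceless_entry X11; apply/matrixP.
by do 2 apply: ord2P; rewrite mulmx2E !mxE ?X11/= ?mulr1n ?mulr0n; ring.
Qed.

Lemma trace_commutator X Y : \tr (X *m Y - Y *m X) = 0.
Proof. by rewrite linearB/= mxtrace_mulC subrr. Qed.

(** M2 is the matrix of the symplectic form of the plane, and sl_2 = sp_2. *)
Lemma M2_traceless_sym X : \tr X = 0 -> (M2 R *m X)^T = M2 R *m X.
Proof.
move=> /traceless_entry X11; apply/matrixP.
by do 2 apply: ord2P; rewrite mxE !mulmx2E !mxE/= ?X11; ring.
Qed.

End TwoByTwoMatrices.

Section MatrixDerivatives.
Context {R : realType}.
Implicit Types (X Y : R -> 'M[R]_2) (t : R).

Lemma is_mx_derive_add X Y t (X' Y' : 'M[R]_2) :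
  is_mx_derive X t X' -> is_mx_derive Y t Y' ->
  is_mx_derive (fun s => X s + Y s) t (X' + Y').
Proof.
move=> hX hY i j; rewrite (_ : (fun s => _) = fun s => X s i j + Y s i j).
  by rewrite mxE; exact: is_derive1_add (hX i j) (hY i j).
by apply/funext => s; rewrite mxE.
Qed.

Lemma is_mx_derive_scale (f : R -> R) X t df (X' : 'M[R]_2) :
  is_derive t 1 f df -> is_mx_derive X t X' ->
  is_mx_derive (fun s => f s *: X s) t (df *: X t + f t *: X').
Proof.
move=> hf hX i j; rewrite (_ : (fun s => _) = fun s => f s * X s i j).
  by rewrite !mxE; exact: is_derive1_mul hf (hX i j).
by apply/funext => s; rewrite mxE.
Qed.

Lemma is_mx_derive_scalec (c : R) X t (X' : 'M[R]_2) :
  is_mx_derive X t X' -> is_mx_derive (fun s => c *: X s) t (c *: X').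
Proof.
move=> hX i j; rewrite (_ : (fun s => _) = fun s => c * X s i j).
  by rewrite mxE; exact: is_derive1_scale (hX i j).
by apply/funext => s; rewrite mxE.
Qed.

Lemma is_mx_derive_mul X Y t (X' Y' : 'M[R]_2) :
  is_mx_derive X t X' -> is_mx_derive Y t Y' ->
  is_mx_derive (fun s => X s *m Y s) t (X' *m Y t + X t *m Y').
Proof.
move=> hX hY i j; rewrite (_ : (fun s => _) =
    fun s => X s i 0 * Y s 0 j + X s i 1 * Y s 1 j).
  apply: is_derive_eq.
    exact: is_derive1_add (is_derive1_mul (hX i 0) (hY 0 j))
                          (is_derive1_mul (hX i 1) (hY 1 j)).
  by rewrite mxE !mulmx2E; ring.
by apply/funext => s; rewrite mulmx2E.
Qed.

Lemma is_mx_derive_opp X t (X' : 'M[R]_2) :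
  is_mx_derive X t X' -> is_mx_derive (fun s => - X s) t (- X').
Proof.
move=> hX i j; rewrite (_ : (fun s => _) = - (fun s => X s i j)).
  by rewrite mxE; exact: is_deriveN.
by apply/funext => s; rewrite mxE.
Qed.

(** The terms are grouped into commutators, the form in which the derivative is
    compared with the system. *)
Lemma is_mx_derive_commutator X Y t (X' Y' : 'M[R]_2) :
  is_mx_derive X t X' -> is_mx_derive Y t Y' ->
  is_mx_derive (fun s => X s *m Y s - Y s *m X s) t
    ((X' *m Y t - Y t *m X') + (X t *m Y' - Y' *m X t)).
Proof.
move=> hX hY i j.
have := is_mx_derive_add (is_mx_derive_mul hX hY)
  (is_mx_derive_opp (is_mx_derive_mul hY hX)) i j.
by rewrite [Y' *m _ + _]addrC opprD addrACA.
Qed.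

(** Gronwall's argument with a vanishing rate, applied to the square of each
    entry of X - X(0). *)
Lemma is_mx_derive0_cst (X : R -> 'M[R]_2) (a b : R) : a < 0 -> 0 < b ->
  (forall t, a < t < b -> is_mx_derive X t 0) ->
  forall t, a < t < b -> X t = X 0.
Proof.
move=> a0 b0 hX t tab; apply/matrixP => i j.
pose u s := X s i j - X 0 i j.
suff : u t * u t <= 0.
  rewrite -expr2 le_eqVlt ltNge sqr_ge0 orbF sqrf_eq0 subr_eq0.
  by move=> /eqP.
apply: (@gronwall_vanish R (fun s => u s * u s) (fun=> 0)
  (fun=> 0) (fun=> 0) a b a0 b0) => //.
- move=> s sab; have h : is_derive s 1 u 0.
    apply: is_derive_eq; first exact: is_derive1_add (hX s sab i j) (is_derive_cst _ _ _).
    by rewrite mxE addr0.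
  by apply: (is_derive_eq (is_derive1_mul h h)); ring.
- by move=> s _; rewrite normr0 mul0r.
- by rewrite /u subrr mulr0.
Qed.

End MatrixDerivatives.

(** * The linear system for F, H, B *)

Section StructureODE.
Context {R : realType}.
Variables (mubar : R -> R) (a b : R).
Hypotheses (a_lt0 : a < 0) (b_gt0 : 0 < b).

Lemma lambdabar_neq0 (t : R) : lambdabar t != 0.
Proof. by rewrite gt_eqF// expR_gt0. Qed.

Lemma expR4_lambdabar (t : R) : expR (4 * t) = lambdabar t ^- 2.
Proof.
by rewrite /lambdabar -expRM_natl -expRN; congr expR; ring.
Qed.

(** The energy f^2 + e^(4t) (h^2 + k^2) has the derivative 8 f h: the weight
    e^(4t) makes the damping terms cancel, and the terms in mubar cancel by
    skew-symmetry.  As 8 |f h| is at most 4 e^(-2t) times the energy, the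
    energy vanishes with its initial value. *)
Lemma scalar_ode_vanish (f h k : R -> R) :
  (forall t, a < t < b -> is_derive t 1 f (2 * h t)) ->
  (forall t, a < t < b -> is_derive t 1 h
     (2 * lambdabar t ^+ 2 * f t - 2 * h t - mubar t * k t)) ->
  (forall t, a < t < b -> is_derive t 1 k (mubar t * h t - 2 * k t)) ->
  f 0 = 0 -> h 0 = 0 -> k 0 = 0 ->
  forall t, a < t < b -> [/\ f t = 0, h t = 0 & k t = 0].
Proof.
move=> hf hh hk f0 h0 k0 t tab.
pose N s := f s * f s + expR (4 * s) * (h s * h s + k s * k s).
have NE s : N s = f s ^+ 2 + expR (4 * s) * (h s ^+ 2 + k s ^+ 2).
  by rewrite /N -!expr2.
have : N t <= 0.
  apply: (@gronwall_vanish R N (fun s => 8 * (f s * h s))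
    (fun s => - 2 * expR (- 2 * s)) (fun s => 4 * lambdabar s) a b) => //.
  - move=> s sab; apply: is_derive_eq.
      apply: is_derive1_add (is_derive1_mul (hf s sab) (hf s sab)) _.
      apply: is_derive1_mul (is_derive1_expRZ 4 s) _.
      exact: is_derive1_add (is_derive1_mul (hh s sab) (hh s sab))
                            (is_derive1_mul (hk s sab) (hk s sab)).
    by rewrite !expR4_lambdabar; field; exact: lambdabar_neq0.
  - move=> s _.
    apply: (is_derive_eq (is_derive1_scale (- 2) (is_derive1_expRZ (- 2) s))).
    by rewrite /lambdabar; ring.
  - move=> s _; rewrite NE expR4_lambdabar.
    have l0 : 0 < lambdabar s by exact: expR_gt0.
    move: (lambdabar s) l0 (f s) (h s) (k s) => l l0 x y z.
    have ln0 : l != 0 by rewrite gt_eqF.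
    have li : 0 < l^-1 by rewrite invr_gt0.
    (* The defect in the bound is a sum of squares. *)
    have e1 : 4 * l * (x ^+ 2 + l ^- 2 * (y ^+ 2 + z ^+ 2)) - 8 * (x * y)
        = 4 * l^-1 * ((l * x - y) ^+ 2 + z ^+ 2) by field.
    have e2 : 4 * l * (x ^+ 2 + l ^- 2 * (y ^+ 2 + z ^+ 2)) + 8 * (x * y)
        = 4 * l^-1 * ((l * x + y) ^+ 2 + z ^+ 2) by field.
    have pos w : 0 <= 4 * l^-1 * (w ^+ 2 + z ^+ 2).
      by apply: mulr_ge0; [lra | exact: addr_ge0 (sqr_ge0 _) (sqr_ge0 _)].
    rewrite ler_norml -subr_ge0 opprK addrC e2 pos/=.
    by rewrite -subr_ge0 e1 pos.
  - by rewrite NE f0 h0 k0 !expr0n/= addr0 mulr0 addr0.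
have p0 : 0 < expR (4 * t) by exact: expR_gt0.
rewrite NE => Nle.
have hk_ge0 := mulr_ge0 (ltW p0) (addr_ge0 (sqr_ge0 (h t)) (sqr_ge0 (k t))).
have /eqP : f t ^+ 2 = 0 by apply/le_anti; rewrite sqr_ge0 andbT; lra.
rewrite sqrf_eq0 => /eqP ft; have /eqP : expR (4 * t) * (h t ^+ 2 + k t ^+ 2) = 0.
  by apply/le_anti; rewrite hk_ge0 andbT; have := sqr_ge0 (f t); lra.
rewrite mulf_eq0 gt_eqF//= paddr_eq0 ?sqr_ge0// !sqrf_eq0.
by move=> /andP[/eqP ? /eqP ?].
Qed.

Lemma ode_solution_unique (F H B F1 H1 B1 : R -> 'M[R]_2) :
  ode_solution mubar a b F H B -> ode_solution mubar a b F1 H1 B1 ->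
  forall t, a < t < b -> [/\ F t = F1 t, H t = H1 t & B t = B1 t].
Proof.
move=> [oF oH oB F0 H0 B0] [oF1 oH1 oB1 F10 H10 B10] t tab.
suff eqs i j : [/\ F t i j - F1 t i j = 0, H t i j - H1 t i j = 0
                  & B t i j - B1 t i j = 0].
  by split; apply/matrixP => i j; apply/eqP; rewrite -subr_eq0; apply/eqP;
    have [] := eqs i j.
have sub (X Y : R -> 'M[R]_2) s (X' Y' : 'M[R]_2) :
    is_mx_derive X s X' -> is_mx_derive Y s Y' ->
    is_derive s 1 (fun r => X r i j - Y r i j) (X' i j - Y' i j).
  by move=> hX hY; exact: is_deriveB (hX i j) (hY i j).
apply: (@scalar_ode_vanish (fun s => F s i j - F1 s i j)
  (fun s => H s i j - H1 s i j) (fun s => B s i j - B1 s i j)) => //.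
- move=> s sab; apply: (is_derive_eq (sub _ _ _ _ _ (oF s sab) (oF1 s sab))).
  by rewrite !mxE; ring.
- move=> s sab; apply: (is_derive_eq (sub _ _ _ _ _ (oH s sab) (oH1 s sab))).
  by rewrite !mxE; ring.
- move=> s sab; apply: (is_derive_eq (sub _ _ _ _ _ (oB s sab) (oB1 s sab))).
  by rewrite !mxE; ring.
- by rewrite F0 F10 subrr.
- by rewrite H0 H10 subrr.
- by rewrite B0 B10 subrr.
Qed.

Variables (F H B : R -> 'M[R]_2).
Hypothesis sol : ode_solution mubar a b F H B.

(** On the triple F, e^(2t) H, e^(2t) B the system acts by derivations of the Lie
    algebra sl_2, so it preserves the bracket relations of the initial values:
    [M3,M1] = -2 M2, [M1,M2] = 2 M3 and [M2,M3] = 2 M1. *)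
Lemma ode_solution_commutators : ode_solution mubar a b
  (fun s => (- 2^-1 * expR (4 * s)) *: (H s *m B s - B s *m H s))
  (fun s => 2^-1 *: (B s *m F s - F s *m B s))
  (fun s => 2^-1 *: (F s *m H s - H s *m F s)).
Proof.
have [oF oH oB F0 H0 B0] := sol; split=> [s sab|s sab|s sab|||].
- have := is_mx_derive_scale
    (is_derive1_scale (- 2^-1) (is_derive1_expRZ 4 s))
    (is_mx_derive_commutator (oH s sab) (oB s sab)).
  congr is_mx_derive; apply/matrixP => i j.
  rewrite !(mulmx2E, mxE) !expR4_lambdabar; field; exact: lambdabar_neq0.
- have := is_mx_derive_scalec 2^-1
    (is_mx_derive_commutator (oB s sab) (oF s sab)).
  congr is_mx_derive; apply/matrixP => i j.
  rewrite !(mulmx2E, mxE) !expR4_lambdabar; field; exact: lambdabar_neq0.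
- have := is_mx_derive_scalec 2^-1
    (is_mx_derive_commutator (oF s sab) (oH s sab)).
  congr is_mx_derive; apply/matrixP => i j.
  by rewrite !(mulmx2E, mxE); field.
- rewrite H0 B0 mulr0 expR0 mulr1; apply/matrixP.
  by do 2 apply: ord2P; rewrite !(mulmx2E, mxE)/=; field.
- rewrite F0 B0; apply/matrixP.
  by do 2 apply: ord2P; rewrite !(mulmx2E, mxE)/=; field.
- rewrite F0 H0; apply/matrixP.
  by do 2 apply: ord2P; rewrite !(mulmx2E, mxE)/=; field.
Qed.

Lemma ode_commutators t : a < t < b ->
  [/\ F t = (- 2^-1 * expR (4 * t)) *: (H t *m B t - B t *m H t),
      H t = 2^-1 *: (B t *m F t - F t *m B t) &
      B t = 2^-1 *: (F t *m H t - H t *m F t)].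
Proof. exact: ode_solution_unique sol ode_solution_commutators t. Qed.

Lemma ode_F_traceless t : a < t < b -> \tr (F t) = 0.
Proof.
by move=> /ode_commutators[-> _ _]; rewrite mxtraceZ trace_commutator mulr0.
Qed.

Lemma ode_H_traceless t : a < t < b -> \tr (H t) = 0.
Proof.
by move=> /ode_commutators[_ -> _]; rewrite mxtraceZ trace_commutator mulr0.
Qed.

(** As H = 1/2 [B,F], the sum is 1/2 [B, F^2], and F^2 is scalar. *)
Lemma ode_F_H_anticommute t : a < t < b -> H t *m F t + F t *m H t = 0.
Proof.
move=> tab; have [_ -> _] := ode_commutators tab.
have BFF : B t *m F t *m F t = F t *m F t *m B t.
  by rewrite -mulmxA (traceless_sqr (ode_F_traceless tab)) scalar_mxC.
rewrite -scalemxAl -scalemxAr -scalerDr mulmxBl mulmxBr BFF !mulmxA subrKA.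
by rewrite subrr scaler0.
Qed.

(** The derivative of F^2 is 2 (H F + F H) = 0, so F^2 keeps its initial value. *)
Lemma ode_F_sqr t : a < t < b -> F t *m F t = - 1%:M.
Proof.
move=> tab; have [oF _ _ F0 _ _] := sol.
rewrite (is_mx_derive0_cst (X := fun s => F s *m F s) a_lt0 b_gt0 _ tab).
  by rewrite F0; apply/matrixP; do 2 apply: ord2P;
    rewrite !(mulmx2E, mxE)/= ?mulr1n ?mulr0n; ring.
move=> s sab; have := is_mx_derive_mul (oF s sab) (oF s sab).
by rewrite -scalemxAl -scalemxAr -scalerDr ode_F_H_anticommute// scaler0.
Qed.

Lemma ode_mulFH t : a < t < b -> F t *m H t = B t.
Proof.
move=> tab; have [_ _ ->] := ode_commutators tab.
have /eqP := ode_F_H_anticommute tab; rewrite addr_eq0 => /eqP ->.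
by rewrite opprK -[X in X + _]scale1r -[X in _ + X]scale1r -scalerDl scalerA mulVf ?scale1r// pnatr_eq0.
Qed.

Lemma ode_mulFB t : a < t < b -> F t *m B t = - H t.
Proof.
by move=> tab; rewrite -(ode_mulFH tab) mulmxA ode_F_sqr// mulNmx mul1mx.
Qed.

(** From F H = B = -H F one finds B^2 = H^2 and [H,B] = -2 F H^2; inserted into
    F = -1/2 e^(4t) [H,B] this gives F = e^(4t) F H^2, and F is invertible. *)
Lemma ode_B_sqr t : a < t < b -> B t *m B t = (lambdabar t ^+ 2)%:M.
Proof.
move=> tab; have FB := ode_mulFB tab; have FH := ode_mulFH tab.
have FF := ode_F_sqr tab.
have HF : H t *m F t = - B t.
  by have /eqP := ode_F_H_anticommute tab; rewrite addr_eq0 FH => /eqP.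
have BB : B t *m B t = H t *m H t.
  by rewrite -{2}FH mulmxA -[B t in LHS]opprK -HF mulNmx -mulmxA FF mulmxN mulmx1 opprK.
have HB : H t *m B t = - (F t *m (H t *m H t)).
  by rewrite -FH mulmxA HF mulNmx -FH mulmxA.
have BH : B t *m H t = F t *m (H t *m H t) by rewrite -FH mulmxA.
have [Fc _ _] := ode_commutators tab.
have half (c : R) (X : 'M[R]_2) : (- 2^-1 * c) *: (- X - X) = c *: X.
  by apply/matrixP => i j; rewrite !mxE; field.
have : F t *m F t = expR (4 * t) *: (F t *m F t *m (H t *m H t)).
  by rewrite {2}Fc HB BH half -scalemxAr !mulmxA.
rewrite FF BB mulNmx mul1mx scalerN => /oppr_inj.
rewrite expR4_lambdabar => HH.
rewrite -[LHS]scale1r -(mulfV (expf_neq0 2 (lambdabar_neq0 t))) -scalerA -HH.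
by rewrite scalemx1.
Qed.

(** The entry is -1 at time 0.  It has no zero, since at a zero the relation
    F^2 = -1 would make the square of another entry equal to -1. *)
Lemma ode_F10_lt0 t : a < t < b -> F t 1 0 < 0.
Proof.
move=> tab; have [oF _ _ F0 _ _] := sol.
have F10_neq0 s : a < s < b -> F s 1 0 != 0.
  move=> sab; apply/eqP => F10.
  have /matrixP/(_ 0 0) := ode_F_sqr sab.
  rewrite mulmx2E F10 mulr0 addr0 !mxE/= => e.
  by have := sqr_ge0 (F s 0 0); rewrite expr2 e oppr_ge0 ler10.
have F100 : F 0 1 0 = -1 by rewrite F0 mxE.
rewrite ltNge; apply/negP => F10t.
have [t0|t0] := leP t 0.
  have inab s : s \in `[t, 0]%R -> a < s < b.
    rewrite in_itv/= => /andP[ts s0].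
    by rewrite (lt_le_trans (andP tab).1 ts) (le_lt_trans s0).
  have cont := derivable_within_continuous
    (fun s sin => @ex_derive _ _ _ _ _ _ _ (oF s (inab s sin) 1 0)).
  have [|c cin /eqP] := @IVT R (fun s => F s 1 0) t 0 0 t0 cont.
    by rewrite ge_min le_max F10t F100 lerN10 orbT.
  by apply/negP; exact: F10_neq0 (inab c cin).
have inab s : s \in `[0, t]%R -> a < s < b.
  rewrite in_itv/= => /andP[s0 st].
  by rewrite (lt_le_trans a_lt0 s0) (le_lt_trans st (andP tab).2).
have cont := derivable_within_continuous
  (fun s sin => @ex_derive _ _ _ _ _ _ _ (oF s (inab s sin) 1 0)).
have [|c cin /eqP] := @IVT R (fun s => F s 1 0) 0 t 0 (ltW t0) cont.
  by rewrite ge_min le_max F10t F100 lerN10 orbT.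
by apply/negP; exact: F10_neq0 (inab c cin).
Qed.

End StructureODE.

(** * Block-diagonal tensors depending on t *)

Section BlockDiagonal.
Context {R : realType}.
Implicit Types (c d : R) (A B : 'M[R]_2).
Local Notation E := 'cV[R]_(1.*2.+1).
Local Notation e0 := (delta_mx 0 0 : E).

Definition bdiag c A : 'M[R]_(1.*2.+1) := block_mx (c%:M : 'M[R]_1) 0 0 A.

Lemma bdiag_mul c d A B : bdiag c A *m bdiag d B = bdiag (c * d) (A *m B).
Proof.
apply: etrans (mulmx_block (c%:M : 'M[R]_1) 0 0 A d%:M 0 0 B) _.
by rewrite !mulmx0 !mul0mx !addr0 add0r -scalar_mxM.
Qed.

Lemma bdiag_add c d A B : bdiag c A + bdiag d B = bdiag (c + d) (A + B).
Proof.
apply: etrans (add_block_mx (c%:M : 'M[R]_1) 0 0 A d%:M 0 0 B) _.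
by rewrite !addr0 -raddfD.
Qed.

Lemma bdiag_scale c d A : c *: bdiag d A = bdiag (c * d) (c *: A).
Proof.
apply: etrans (scale_block_mx c (d%:M : 'M[R]_1) 0 0 A) _.
by rewrite !scaler0 scale_scalar_mx.
Qed.

Lemma bdiag_opp c A : - bdiag c A = bdiag (- c) (- A).
Proof. by rewrite -scaleN1r bdiag_scale mulN1r scaleN1r. Qed.

Lemma bdiag_tr c A : (bdiag c A)^T = bdiag c A^T.
Proof.
by rewrite /bdiag (tr_block_mx (c%:M : 'M[R]_1) 0 0 A) tr_scalar_mx !trmx0.
Qed.

Lemma bdiag1 : bdiag 1 1%:M = 1%:M.
Proof. by rewrite /bdiag -(scalar_mx_block 1 2). Qed.

Lemma e0_col : e0 = col_mx (1%:M : 'M[R]_1) (0 : 'cV[R]_2).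
Proof.
apply/matrixP => i j; rewrite (ord1 j) !mxE.
case: (splitP (i : 'I_(1 + 2))) => k ik; rewrite !mxE -val_eqE/= ik.
  by rewrite (ord1 k) eqxx.
by rewrite andbT.
Qed.

Lemma bdiag_e0 c A : bdiag c A *m e0 = c *: e0.
Proof.
rewrite e0_col; apply: etrans (mul_block_col (c%:M : 'M[R]_1) 0 0 A _ _) _.
apply: esym; apply: etrans (scale_col_mx c (1%:M : 'M[R]_1) (0 : 'cV[R]_2)) _.
by rewrite mulmx1 !mulmx0 mul0mx !addr0 scalemx1 scaler0.
Qed.

Lemma e0_eta : e0 *m (delta_mx 0 0 : 'rV[R]_(1.*2.+1)) = bdiag 1 0.
Proof.
rewrite -[delta_mx 0 0 : 'rV[R]__]trmx_delta e0_col.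
have -> : (col_mx (1%:M : 'M[R]_1) (0 : 'cV[R]_2))^T
    = row_mx (1%:M : 'M[R]_1) (0 : 'rV[R]_2) by rewrite tr_col_mx tr_scalar_mx trmx0.
apply: etrans (mul_col_row (1%:M : 'M[R]_1) (0 : 'cV[R]_2) 1%:M 0) _.
by rewrite mul1mx !mulmx0 mul0mx.
Qed.

(** Each entry of a block-diagonal matrix is either independent of the lower
    block or an entry of that block, so calculus on such tensors reduces to
    calculus on the entries of the block. *)
Lemma bdiag_entry i j :
  (exists2 k : R -> R, k 0 = 0 & forall c A, bdiag c A i j = k c)
  \/ exists k l, forall c A, bdiag c A i j = A k l.
Proof.
case: (split_ordP (i : 'I_(1 + 2))) => i' ->;
  case: (split_ordP (j : 'I_(1 + 2))) => j' ->.
- left; exists (fun c => (c%:M : 'M[R]_1) i' j'); first by rewrite raddf0 mxE.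
  by move=> c A; exact: block_mxEul.
- left; exists (fun=> 0) => // c A.
  by apply: etrans (block_mxEur _ _ _ _ i' j') _; rewrite mxE.
- left; exists (fun=> 0) => // c A.
  by apply: etrans (block_mxEdl _ _ _ _ i' j') _; rewrite mxE.
- by right; exists i', j' => c A; exact: block_mxEdr.
Qed.

Lemma bilin_bdiag c A (u0 : 'M[R]_1) (d : 'cV[R]_2) :
  let u : E := col_mx u0 d in
  bilin (bdiag c A) u u = c * u0 0 0 ^+ 2 + (d^T *m A *m d) 0 0.
Proof.
move=> u.
have uA : u^T *m bdiag c A = row_mx (u0^T *m c%:M) (d^T *m A).
  apply: etrans (congr1 (mulmx^~ (bdiag c A)) (tr_col_mx u0 d)) _.
  apply: etrans (mul_row_block u0^T d^T (c%:M : 'M[R]_1) 0 0 A) _.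
  by rewrite !mulmx0 addr0 add0r.
have uAu : u^T *m bdiag c A *m u = u0^T *m c%:M *m u0 + d^T *m A *m d.
  by rewrite uA; exact: (mul_row_col (u0^T *m c%:M) (d^T *m A) u0 d).
rewrite /bilin uAu addmx_entry; congr (_ + _).
by rewrite mul_mx_scalar -scalemxAl !mxE big_ord1 mxE -expr2.
Qed.

End BlockDiagonal.

Section FunctionsOfTime.
Context {R : realType}.
Local Notation E := 'cV[R]_(1.*2.+1).
Implicit Types (x v : E) (h : R -> R).

Lemma tcoord_differentiable x : differentiable (@tcoord R) x.
Proof. exact: differentiable_coord. Qed.

Lemma differentiable_tcoord h x dh : is_derive (tcoord x) 1 h dh ->
  differentiable (fun y => h (tcoord y)) x.
Proof.
move=> hh; apply: differentiable_comp; first exact: tcoord_differentiable.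
exact/derivable1_diffP.
Qed.

Lemma derive_tcoord h x v dh : is_derive (tcoord x) 1 h dh ->
  'D_v (fun y => h (tcoord y)) x = v 0 0 * dh.
Proof.
move=> hh; have dh1 : differentiable h (tcoord x) by exact/derivable1_diffP.
rewrite deriveE; last exact: differentiable_tcoord hh.
rewrite (diff_comp (tcoord_differentiable x) dh1)/=.
have dt : 'd (@tcoord R) x v = v 0 0.
  rewrite -deriveE; last exact: tcoord_differentiable.
  have did : entries_differentiable (@id E) x.
    by move=> i j; exact: differentiable_coord.
  by rewrite -[RHS](congr1 (fun w : E => w 0 0) (derive_id x v)) (derive_entry v 0 0 did).
by rewrite dt diff1E// derive1E (@derive_val _ _ _ _ _ _ _ hh).
Qed.

Lemma slab_open (a b : R) : open (slab a b).
Proof.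
have -> : slab a b = @tcoord R @^-1` `]a, b[.
  by apply/seteqP; split => x; rewrite /slab /= in_itv.
apply: (@open_comp _ _ (@tcoord R)); last exact: interval_open.
move=> x _; apply: differentiable_continuous.
exact: tcoord_differentiable.
Qed.

Lemma bdiag_tcoord_differentiable c (A : R -> 'M[R]_2) x A' :
  is_mx_derive A (tcoord x) A' ->
  entries_differentiable (fun y => bdiag c (A (tcoord y))) x.
Proof.
move=> hA i j; have [[k _ kE]|[k [l klE]]] := @bdiag_entry R i j.
  have -> : (fun y => bdiag c (A (tcoord y)) i j) = cst (k c).
    by apply/funext => y; exact: kE.
  exact: differentiable_cst.
have -> : (fun y => bdiag c (A (tcoord y)) i j) = fun y => A (tcoord y) k l.
  by apply/funext => y; exact: klE.
exact: (differentiable_tcoord (h := fun t => A t k l)) (hA k l).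
Qed.

Lemma derive_bdiag_tcoord c (A : R -> 'M[R]_2) x v A' :
  is_mx_derive A (tcoord x) A' ->
  'D_v (fun y => bdiag c (A (tcoord y))) x = v 0 0 *: bdiag 0 A'.
Proof.
move=> hA; apply/matrixP => i j.
apply: etrans (derive_entry v i j (bdiag_tcoord_differentiable c hA)) _.
rewrite scalemx_entry; have [[k k0 kE]|[k [l klE]]] := @bdiag_entry R i j.
  have -> : (fun y => bdiag c (A (tcoord y)) i j) = cst (k c).
    by apply/funext => y; exact: kE.
  by rewrite derive_cst kE k0 mulr0.
have -> : (fun y => bdiag c (A (tcoord y)) i j) = fun y => A (tcoord y) k l.
  by apply/funext => y; exact: klE.
rewrite klE; exact: (derive_tcoord (h := fun t => A t k l)) (hA k l).
Qed.

Lemma smooth_bdiag (U : set E) (openU : open U) c (A : E -> 'M[R]_2) :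
  smooth_mx_on U A -> smooth_mx_on U (fun x => bdiag c (A x)).
Proof.
move=> sA i j; have [[k _ kE]|[k [l klE]]] := @bdiag_entry R i j.
  have -> : (fun y => bdiag c (A y) i j) = cst (k c).
    by apply/funext => y; exact: kE.
  exact: smooth_cst.
have -> : (fun y => bdiag c (A y) i j) = fun y => A y k l.
  by apply/funext => y; exact: klE.
exact: sA.
Qed.

End FunctionsOfTime.

(** * The constructed almost contact metric manifold *)

Section ConstructedManifold.
Context {R : realType}.
Local Notation E := 'cV[R]_(1.*2.+1).
Local Notation e0 := (delta_mx 0 0 : E).
Variables (mubar : R -> R) (a b : R) (F H B : R -> 'M[R]_2).
Hypothesis mubar_smooth :
  forall (k : nat) (t : R), derivable (derive1n k mubar) t 1.
Hypotheses (a_lt0 : a < 0) (b_gt0 : 0 < b).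
Hypothesis sol : ode_solution mubar a b F H B.

Local Notation M := (slab a b).
Let openM : open M := @slab_open R a b.

(** Besides F, H and B, the family has to contain the exponentials and all
    derivatives of mubar in order to be stable, as a generating set, under d/dt. *)
Inductive time_function : (R -> R) -> Prop :=
| time_expR c : time_function (fun t => expR (c * t))
| time_mubar k : time_function (derive1n k mubar)
| time_F i j : time_function (fun t => F t i j)
| time_H i j : time_function (fun t => H t i j)
| time_B i j : time_function (fun t => B t i j).

Definition pulled_back (f : E -> R) :=
  exists2 h, time_function h & f = fun x => h (tcoord x).

Let gen := generated M pulled_back.

Let gen_time h : time_function h -> gen (fun x => h (tcoord x)).
Proof. by move=> th; apply: generated_base; exists h. Qed.

Let gen_scale c f : gen f -> gen (fun x => c * f x).
Proof. by move=> gf; exact: generated_mul (generated_cst _ _ c) gf. Qed.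

Let gen_sub f g : gen f -> gen g -> gen (fun x => f x - g x).
Proof.
move=> gf gg; apply: generated_ext (generated_add gf (gen_scale (-1) gg)) _.
by move=> x _; rewrite mulN1r.
Qed.

(** The system expresses the derivatives of F, H, B as polynomials in functions
    of the family. *)
Lemma time_function_derive h : time_function h ->
  exists2 dh, forall t, a < t < b -> is_derive t 1 h (dh t)
            & gen (fun x => dh (tcoord x)).
Proof.
have [oF oH oB _ _ _] := sol; case.
- move=> c; exists (fun t => c * expR (c * t)) => [t _|].
    exact: is_derive1_expRZ.
  exact: gen_scale (gen_time (time_expR c)).
- move=> k; exists (derive1n k.+1 mubar) => [t _|].
    rewrite derive1nS derive1E; exact: derivableP.
  exact: gen_time (time_mubar k.+1).
- move=> i j; exists (fun t => (2 *: H t) i j) => [t tab|]; first exact: oF.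
  apply: generated_ext (gen_scale 2 (gen_time (time_H i j))) _ => x _.
  by rewrite scalemx_entry.
- move=> i j; exists (fun t =>
    ((2 * lambdabar t ^+ 2) *: F t - 2 *: H t - mubar t *: B t) i j) => [t tab|].
    exact: oH.
  have gl := gen_time (time_expR (-2)).
  apply: generated_ext (gen_sub (gen_sub (generated_mul
      (gen_scale 2 (generated_mul gl gl)) (gen_time (time_F i j)))
      (gen_scale 2 (gen_time (time_H i j))))
    (generated_mul (gen_time (time_mubar 0)) (gen_time (time_B i j)))) _.
  by move=> x _; rewrite !mxE /lambdabar expr2.
- move=> i j; exists (fun t => (mubar t *: H t - 2 *: B t) i j) => [t tab|].
    exact: oB.
  apply: generated_ext (gen_sub
    (generated_mul (gen_time (time_mubar 0)) (gen_time (time_H i j)))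
    (gen_scale 2 (gen_time (time_B i j)))) _.
  by move=> x _; rewrite !mxE.
Qed.

Lemma time_smooth f : gen f -> smooth_on M f.
Proof.
apply: generated_smooth => // _ [h th ->].
have [dh hdh gdh] := time_function_derive th; split=> [x Mx|i].
  exact: differentiable_tcoord (hdh _ Mx).
apply: generated_ext (gen_scale ((delta_mx i 0 : E) 0 0) gdh) _ => x Mx.
by rewrite /partial (derive_tcoord _ (hdh _ Mx)).
Qed.

(** The matrix e^(2t) G of the metric on the slices t = constant, and below its
    derivative, computed from F' = 2 H. *)
Definition space_metric (t : R) : 'M[R]_2 := expR (2 * t) *: (- M2 R *m F t).
Definition space_metric' (t : R) : 'M[R]_2 :=
  (2 * expR (2 * t)) *: (- M2 R *m (F t + H t)).

(** The shape operator 1/2 S^-1 S' in closed form: S^-1 S' = 2 + F^-1 F', where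
    F^-1 F' = -2 F H = -2 B. *)
Definition shape (x : E) := bdiag 0 (1%:M - B (tcoord x)).
Definition shape' (x : E) :=
  bdiag 0 (2 *: B (tcoord x) - mubar (tcoord x) *: H (tcoord x)).

Local Notation G := (fun t : R => - M2 R *m F t).
Definition metric' (x : E) := bdiag 0 (space_metric' (tcoord x)).

Lemma metricE x : metric G x = bdiag 1 (space_metric (tcoord x)).
Proof. by []. Qed.

Lemma phi_endoE x : phi_endo F x = bdiag 0 (F (tcoord x)).
Proof. by rewrite /phi_endo /bdiag raddf0. Qed.

Lemma is_mx_derive_mull (C : 'M[R]_2) (X : R -> 'M[R]_2) t (X' : 'M[R]_2) :
  is_mx_derive X t X' -> is_mx_derive (fun s => C *m X s) t (C *m X').
Proof.
move=> hX i j; rewrite (_ : (fun s => _) =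
    fun s => C i 0 * X s 0 j + C i 1 * X s 1 j).
  rewrite mulmx2E.
  exact: is_derive1_add (is_derive1_scale _ (hX 0 j)) (is_derive1_scale _ (hX 1 j)).
by apply/funext => s; rewrite mulmx2E.
Qed.

Lemma space_metric_derive t : a < t < b ->
  is_mx_derive space_metric t (space_metric' t).
Proof.
move=> tab; have [oF _ _ _ _ _] := sol.
have := is_mx_derive_scale (is_derive1_expRZ 2 t)
  (is_mx_derive_mull (- M2 R) (oF t tab)).
congr is_mx_derive; rewrite /space_metric' mulmxDr scalerDr -scalemxAr scalerA.
by rewrite [_ * 2]mulrC.
Qed.

Lemma space_metric_sym t : a < t < b -> (space_metric t)^T = space_metric t.
Proof.
move=> tab; rewrite /space_metric linearZ/= mulNmx linearN/=.
by rewrite M2_traceless_sym// (ode_F_traceless a_lt0 b_gt0 sol).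
Qed.

Lemma space_metric'_sym t : a < t < b -> (space_metric' t)^T = space_metric' t.
Proof.
move=> tab; rewrite /space_metric' linearZ/= mulNmx linearN/=.
rewrite M2_traceless_sym// mxtraceD (ode_F_traceless a_lt0 b_gt0 sol)//.
by rewrite (ode_H_traceless a_lt0 b_gt0 sol)// addr0.
Qed.

Lemma space_metric_shape t : a < t < b ->
  space_metric t *m (1%:M - B t) = 2^-1 *: space_metric' t.
Proof.
move=> tab; rewrite /space_metric /space_metric' scalerA mulrA mulVf ?pnatr_eq0//.
rewrite mul1r -scalemxAl -mulmxA mulmxBr mulmx1 (ode_mulFB a_lt0 b_gt0 sol)//.
by rewrite opprK.
Qed.

Lemma space_metric_F t : a < t < b -> space_metric t *m F t = expR (2 * t) *: M2 R.
Proof.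
move=> tab; rewrite /space_metric -scalemxAl -mulmxA (ode_F_sqr a_lt0 b_gt0 sol)//.
by rewrite mulNmx mulmxN opprK mulmx1.
Qed.

Lemma M2_tr : (M2 R)^T = - M2 R.
Proof.
by apply/matrixP; do 2 apply: ord2P; rewrite !mxE/= ?oppr0 ?opprK.
Qed.

(** Since e^(-2t) S F = M2, the left side is e^(2t) F^T M2, the transpose of
    -e^(2t) M2 F = S. *)
Lemma space_metric_compat t : a < t < b ->
  (F t)^T *m space_metric t *m F t = space_metric t.
Proof.
move=> tab; rewrite -mulmxA space_metric_F// -scalemxAr; congr (_ *: _).
have FG := M2_traceless_sym (ode_F_traceless a_lt0 b_gt0 sol tab).
by rewrite mulNmx -FG trmx_mul M2_tr mulmxN opprK.
Qed.

Lemma quadratic_form2 (A : 'M[R]_2) (d : 'cV[R]_2) :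
  (d^T *m A *m d) 0 0 = A 0 0 * d 0 0 ^+ 2
    + (A 0 1 + A 1 0) * (d 0 0 * d 1 0) + A 1 1 * d 1 0 ^+ 2.
Proof. by rewrite !mxE !sum_ord2 !mxE !sum_ord2 !mxE; ring. Qed.

(** The matrix G has the determinant 1 (that is, F^2 = -1) and the positive
    diagonal entry -F_10; complete the square. *)
Lemma space_metric_pos t (d : 'cV[R]_2) : a < t < b -> d != 0 ->
  0 < (d^T *m space_metric t *m d) 0 0.
Proof.
move=> tab d0; rewrite quadratic_form2 /space_metric mulNmx !mxE !sum_ord2 !mxE/=.
have F10 := ode_F10_lt0 a_lt0 b_gt0 sol tab.
have F11 := traceless_entry (ode_F_traceless a_lt0 b_gt0 sol tab).
have /matrixP/(_ 0 0) := ode_F_sqr a_lt0 b_gt0 sol tab.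
rewrite mulmx2E !mxE/= F11.
have {d0} : (d 0 0 != 0) || (d 1 0 != 0).
  rewrite -negb_and; apply: contra d0 => /andP[/eqP z0 /eqP z1].
  by apply/eqP/matrixP => i j; rewrite (ord1 j) [RHS]mxE; move: i; exact: ord2P.
move: F10 (expR_gt0 (2 * t)).
move: (F t 1 0) (F t 0 0) (F t 0 1) (d 0 0) (d 1 0) (expR (2 * t)).
move=> p q r x y c p_lt0 c_gt0 xy detF.
have key : - p * (c * (- p * x ^+ 2 + 2 * q * x * y + r * y ^+ 2))
    = c * ((p * x - q * y) ^+ 2 + y ^+ 2).
  apply/eqP; rewrite -subr_eq0; apply/eqP.
  transitivity (- c * y ^+ 2 * (q * q + r * p + 1)); first by ring.
  by rewrite detF addNr mulr0.
have : 0 < - p * (c * (- p * x ^+ 2 + 2 * q * x * y + r * y ^+ 2)).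
  rewrite key pmulr_rgt0//; have [y0|y0] := eqVneq y 0.
    move: xy; rewrite y0 eqxx orbF mulr0 subr0 expr0n addr0 => x0.
    by rewrite exprn_even_gt0// mulf_neq0// lt_eqF.
  by rewrite ltr_wpDl ?sqr_ge0// exprn_even_gt0.
rewrite pmulr_rgt0 ?oppr_gt0//; congr (0 < _); ring.
Qed.


Lemma smooth_entry (X : R -> 'M[R]_2) : (forall i j, time_function (fun t => X t i j)) ->
  smooth_mx_on M (fun x => X (tcoord x)).
Proof. by move=> tX i j; exact: time_smooth (gen_time (tX i j)). Qed.

Lemma smooth_F : smooth_mx_on M (fun x => F (tcoord x)).
Proof. exact: smooth_entry time_F. Qed.

Lemma smooth_H : smooth_mx_on M (fun x => H (tcoord x)).
Proof. exact: smooth_entry time_H. Qed.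

Lemma smooth_B : smooth_mx_on M (fun x => B (tcoord x)).
Proof. exact: smooth_entry time_B. Qed.

Lemma smooth_expR c : smooth_on M (fun x => expR (c * tcoord x)).
Proof. exact: time_smooth (gen_time (time_expR c)). Qed.

Lemma smooth_mubar : smooth_on M (fun x : E => mubar (tcoord x)).
Proof. exact: time_smooth (gen_time (time_mubar 0)). Qed.

Lemma smooth_metric : smooth_mx_on M (metric G).
Proof.
apply: (smooth_bdiag openM); apply: smooth_mx_scale => //; first exact: smooth_expR.
by apply: smooth_mx_mul => //; [exact: smooth_mx_cst|exact: smooth_F].
Qed.

Lemma smooth_metric' : smooth_mx_on M metric'.
Proof.
apply: (smooth_bdiag openM); apply: smooth_mx_scale => //.
  by apply: smooth_mul => //; [exact: smooth_cst|exact: smooth_expR].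
apply: smooth_mx_mul => //; first exact: smooth_mx_cst.
by apply: smooth_mx_add => //; [exact: smooth_F|exact: smooth_H].
Qed.

Lemma smooth_shape : smooth_mx_on M shape.
Proof.
apply: (smooth_bdiag openM) => i j.
apply: smooth_ext (smooth_add openM (smooth_cst openM ((1%:M : 'M[R]_2) i j))
  (smooth_mul openM (smooth_cst openM (-1)) (smooth_B i j))) _ => // x _.
by rewrite /= mulN1r !mxE.
Qed.

Lemma derive_metric x (v : E) : M x -> 'D_v (metric G) x = v 0 0 *: metric' x.
Proof.
by move=> Mx; exact: (derive_bdiag_tcoord 1 v (space_metric_derive Mx)).
Qed.

Lemma derive_shape x (v : E) : M x -> 'D_v shape x = v 0 0 *: shape' x.
Proof.
move=> Mx; have [_ _ oB _ _ _] := sol.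
apply: (derive_bdiag_tcoord 0 v (A := fun t => 1%:M - B t)) => i j.
have : is_derive (tcoord x) 1 (fun t => - B t i j)
    ((2 *: B (tcoord x) - mubar (tcoord x) *: H (tcoord x)) i j).
  apply: (is_derive_eq (is_deriveN (oB _ Mx i j))).
  by rewrite !mxE opprB.
move=> hB; apply: (is_derive_eq (f := fun t => (1%:M - B t) i j)).
  rewrite (_ : (fun t => _) = fun t => (1%:M : 'M[R]_2) i j + - B t i j).
    exact: is_derive1_add (is_derive_cst _ _ _) hB.
  by apply/funext => t; rewrite !mxE.
exact: add0r.
Qed.

Lemma metric_e0 x : metric G x *m e0 = e0.
Proof. by rewrite metricE bdiag_e0 scale1r. Qed.

Lemma shape_e0 x : shape x *m e0 = 0.
Proof. by rewrite bdiag_e0 scale0r. Qed.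

Lemma metric_shape x : M x -> metric G x *m shape x = 2^-1 *: metric' x.
Proof.
move=> Mx; rewrite metricE bdiag_mul bdiag_scale !mulr0.
by rewrite space_metric_shape.
Qed.

Lemma metric_sym x : M x -> (metric G x)^T = metric G x.
Proof. by move=> Mx; rewrite metricE bdiag_tr space_metric_sym. Qed.

Lemma metric'_sym x : M x -> (metric' x)^T = metric' x.
Proof. by move=> Mx; rewrite bdiag_tr space_metric'_sym. Qed.

(** By B' = mubar H - 2 B, the left side is
    (2 B - mubar H) + (1 - 2 B + B^2), and B^2 = e^(-4t). *)
Lemma shape_riccati x : M x ->
  shape' x + shape x *m shape x
  = (1 + lambdabar (tcoord x) ^+ 2) *: bdiag 0 1%:M
    - mubar (tcoord x) *: bdiag 0 (H (tcoord x)).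
Proof.
move=> Mx; rewrite -scaleNr !bdiag_scale bdiag_mul !bdiag_add; congr bdiag.
  by rewrite !mulr0 addr0.
rewrite mulmxBr mulmxBl mulmxBl !mulmx1 !mul1mx (ode_B_sqr a_lt0 b_gt0 sol)//.
by apply/matrixP => i j; rewrite !mxE; case: (i == j); rewrite ?mulr1n ?mulr0n; ring.
Qed.

Lemma bdiag01 (u : E) : bdiag 0 1%:M *m u = u - u 0 0 *: e0.
Proof.
have -> : bdiag 0 (1%:M : 'M[R]_2) = 1%:M - e0 *m (delta_mx 0 0 : 'rV_(1.*2.+1)).
  by rewrite e0_eta -bdiag1 bdiag_opp bdiag_add subrr subr0.
rewrite mulmxBl mul1mx -mulmxA -rowE; congr (_ - _).
apply/matrixP => i j; rewrite !mxE big_ord1 !mxE (ord1 j) mulrC.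
by rewrite andbT.
Qed.

Lemma form_app_eta (X : E -> E) x : form_app (@eta_form R) X x = X x 0 0.
Proof. by rewrite /form_app /eta_form -rowE mxE. Qed.

Lemma constructed_acm :
  almost_contact_metric (n := 1) M (phi_endo F) (@xi_field R) (@eta_form R) (metric G).
Proof.
split.
- exact: openM.
- move=> i j; apply: smooth_ext (smooth_bdiag openM 0 smooth_F i j) _ => // x _.
  by rewrite phi_endoE.
- exact: smooth_mx_cst.
- exact: smooth_mx_cst.
- split; [exact: smooth_metric|exact: metric_sym|move=> x Mx u u0].
  rewrite -(vsubmxK (u : 'cV_(1 + 2))) metricE.
  rewrite (bilin_bdiag 1 (space_metric (tcoord x))
    (usubmx (u : 'cV_(1 + 2))) (dsubmx (u : 'cV_(1 + 2)))) mul1r.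
  set p := usubmx _; set d := dsubmx _.
  have [d0|dn0] := eqVneq d 0.
    rewrite d0 mulmx0 [X in _ + X]mxE addr0 exprn_even_gt0//=.
    apply: contra u0 => /eqP p0; apply/eqP.
    rewrite -(vsubmxK (u : 'cV_(1 + 2))) -/p -/d d0.
    have -> : p = 0 by apply/matrixP => i j; rewrite !ord1 p0 mxE.
    have col0 : col_mx (0 : 'cV[R]_1) (0 : 'cV[R]_2) = 0 by exact: col_mx0.
    exact: col0.
  by rewrite ltr_wpDl ?sqr_ge0// space_metric_pos.
- move=> x Mx; rewrite phi_endoE bdiag_mul (ode_F_sqr a_lt0 b_gt0 sol)// e0_eta.
  by rewrite mulr0 -bdiag1 bdiag_opp bdiag_add addNr addr0.
- by move=> x Mx; rewrite form_app_eta /xi_field mxE.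
- move=> X Y sX sY x Mx; rewrite !form_app_eta /bilin_app /endo_app.
  rewrite bilin_mull bilin_mulr metricE phi_endoE bdiag_tr !bdiag_mul.
  rewrite space_metric_compat// !mul0r.
  have -> : bdiag 1 (space_metric (tcoord x))
      = bdiag 0 (space_metric (tcoord x)) + e0 *m (delta_mx 0 0 : 'rV_(1.*2.+1)).
    by rewrite e0_eta bdiag_add add0r addr0.
  rewrite bilin_mxD; set c := bilin (_ *m _) _ _.
  suff -> : c = X x 0 0 * Y x 0 0 by rewrite addrK.
  rewrite /c /bilin mulmxA -mulmxA -rowE -colE mxE big_ord1.
  by rewrite !mxE.
Qed.

Lemma bdiag0_scale c (A : 'M[R]_2) : c *: bdiag 0 A = bdiag 0 (c *: A).
Proof. by rewrite bdiag_scale mulr0. Qed.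

(** On the slab the 2-form has the matrix e^(2t) M2, because S F = e^(2t) M2. *)
Lemma fundamental_form_derive x (v : E) : M x ->
  'D_v (fun y => metric G y *m phi_endo F y) x
  = (2 * v 0 0) *: (metric G x *m phi_endo F x).
Proof.
move=> Mx; have eq y : M y -> metric G y *m phi_endo F y
    = bdiag 0 (expR (2 * tcoord y) *: M2 R).
  by move=> My; rewrite metricE phi_endoE bdiag_mul mul1r space_metric_F.
rewrite (eq_derive_on openM v Mx eq) eq//.
rewrite (@derive_bdiag_tcoord _ 0 (fun t => expR (2 * t) *: M2 R) x v
  (2 *: (expR (2 * tcoord x) *: M2 R))).
  by rewrite -bdiag0_scale scalerA mulrC.
move=> i j; rewrite (_ : (fun s => _) = fun s => M2 R i j * expR (2 * s)).
  apply: (is_derive_eq (is_derive1_scale _ (is_derive1_expRZ _ _))).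
  by rewrite !scalemx_entry; ring.
by apply/funext => s; rewrite scalemx_entry mulrC.
Qed.

Lemma constructed_almost_kenmotsu :
  almost_kenmotsu (n := 1) M (phi_endo F) (@xi_field R) (@eta_form R) (metric G).
Proof.
have dif := smooth_mx_differentiable.
split; first exact: constructed_acm.
- move=> X Y sX sY x Mx; apply: ext_derivative1_cst.
    exact: dif sX Mx.
  exact: dif sY Mx.
- move=> X Y Z sX sY sZ x Mx.
  have PhiE : fundamental_form (n := 1) (phi_endo F) (metric G)
      = bilin_app (fun y => metric G y *m phi_endo F y).
    by apply/funext => V; apply/funext => W; apply/funext => y;
      exact: bilin_mulr.
  have sphi := acm_smooth_phi constructed_acm.
  have dOm : entries_differentiable (fun y => metric G y *m phi_endo F y) x.
    by apply: entries_differentiableM; [exact: dif smooth_metric Mx|exact: dif sphi Mx].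
  rewrite PhiE ext_derivative2_bilin//; [|idtac|exact: dif sX Mx|exact: dif sY Mx|exact: dif sZ Mx].
    rewrite /wedge12 !form_app_eta !fundamental_form_derive// !bilin_mxZ /bilin_app.
    by ring.
  rewrite metricE phi_endoE bdiag_mul bdiag_tr space_metric_F// linearZ/= M2_tr.
  by rewrite bdiag_opp mulr0 oppr0 scalerN.
Qed.

(** As xi is a constant field, L_xi phi = dphi/dt = 2 H. *)
Lemma h_tensorE (X : E -> E) x : smooth_mx_on M X -> M x ->
  h_tensor (n := 1) (phi_endo F) (@xi_field R) X x = bdiag 0 (H (tcoord x)) *m X x.
Proof.
move=> sX Mx; have [oF _ _ _ _ _] := sol.
have dif := smooth_mx_differentiable.
rewrite /h_tensor (lie_derivative_endo_cst (m := 1.*2) e0); last 2 first.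
- exact: dif (acm_smooth_phi constructed_acm) Mx.
- exact: dif sX Mx.
have -> : phi_endo F = fun y => bdiag 0 (F (tcoord y)).
  by apply/funext => y; exact: phi_endoE.
rewrite (derive_bdiag_tcoord 0 e0 (oF _ Mx)) mxE/= scale1r.
rewrite scalemxAl bdiag_scale mulr0 scalerA mulVf ?pnatr_eq0//.
by rewrite scale1r.
Qed.

Lemma kappa_lambdabar (t : R) : - 1 - expR (- 4 * t) = - (1 + lambdabar t ^+ 2).
Proof.
have -> : lambdabar t ^+ 2 = expR (- 4 * t).
  by rewrite /lambdabar -expRM_natl; congr expR; ring.
by ring.
Qed.

Lemma constructed_generalized_kappa_mu :
  generalized_kappa_mu (n := 1) M (phi_endo F) (@xi_field R) (@eta_form R)
    (metric G) (fun x : E => - 1 - expR (- 4 * tcoord x))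
    (fun x : E => mubar (tcoord x)).
Proof.
split; first exact: constructed_almost_kenmotsu.
- apply: time_smooth; apply: gen_sub (generated_cst _ _ (-1)) _.
  exact: gen_time (time_expR (-4)).
- exact: smooth_mubar.
exists (cylinder_connection metric' shape); split.
  exact: (cylinder_connection_levi_civita openM smooth_metric smooth_metric'
    smooth_shape metric_sym metric'_sym derive_metric
    (fun x _ => metric_e0 x) metric_shape).
move=> X Y sX sY x Mx.
rewrite (cylinder_curvature_e0 openM smooth_metric' smooth_shape metric_sym
  metric'_sym derive_shape (fun x _ => metric_e0 x) (fun x _ => shape_e0 x)
  metric_shape sX sY Mx).
rewrite shape_riccati// !h_tensorE// !form_app_eta kappa_lambdabar.
rewrite !mulmxBl -!scalemxAl !bdiag01.
move: (X x) (Y x) (bdiag 0 _ *m X x) (bdiag 0 _ *m Y x) => u v hu hv.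
by apply/matrixP => i j; rewrite !mxE; ring.
Qed.

End ConstructedManifold.

Theorem proposition6p2 (R : realType) (mubar : R -> R) (a b : R)
    (F H B : R -> 'M[R]_2)
    (mubar_smooth : forall (k : nat) (t : R), derivable (derive1n k mubar) t 1)
    (a_lt0 : a < 0) (b_gt0 : 0 < b)
    (FHB_sol : ode_solution mubar a b F H B) :
  let M := slab a b in
  let G := fun t : R => - M2 R *m F t in
  let xi := @xi_field R in
  let eta := @eta_form R in
  let g := metric G in
  let phi := phi_endo F in
  let kappa := fun x : 'cV[R]_(1.*2.+1) => - 1 - expR (- 4 * tcoord x) in
  let mu := fun x : 'cV[R]_(1.*2.+1) => mubar (tcoord x) in
  generalized_kappa_mu (n := 1) M phi xi eta g kappa mu /\
  (forall X Y : 'cV[R]_(1.*2.+1) -> 'cV[R]_(1.*2.+1),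
     smooth_mx_on M X -> smooth_mx_on M Y ->
     forall x, M x -> wedge11 (differential kappa) (form_app eta) X Y x = 0).
Proof.
move=> M G xi eta g phi kappa mu; split.
  exact: (constructed_generalized_kappa_mu mubar_smooth a_lt0 b_gt0 FHB_sol).
move=> X Y _ _ x _; rewrite /wedge11 /differential /vfield_derive !form_app_eta.
have dkappa : is_derive (tcoord x) 1 (fun t : R => - 1 - expR (- 4 * t))
    (- (- 4 * expR (- 4 * tcoord x))).
  apply: (is_derive_eq (is_derive1_add (f := fun=> -1)
    (g := fun t => - expR (- 4 * t)) (is_derive_cst (-1 : R) _ _)
    (is_deriveN (is_derive1_expRZ (- 4) (tcoord x))))).
  by rewrite add0r.
rewrite !(derive_tcoord _ dkappa); ring.
Qed.
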